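(* Let $X$ be a discrete metric space of bounded geometry, let $U$ be a non-empty invariant open subset of $\beta X$, and let $\mathcal{R}:=\mathcal{R}_{\max}(U)$. If $X$ has partial property A towards $\beta X\setminus U$, then $I(\mathcal{R})=\tilde I(\mathcal{R})$.
   Context: Bounded geometry: for every $r>0$, $\sup_{x\in X}\sharp B(x,r)<\infty$. A subset $E\subseteq X\times X$ is an entourage if $\sup_{(x,y)\in E}d(x,y)<\infty$. Put $E_r=\{(x,y): d(x,y)\le r\}$. Roe algebra: Fix a separable infinite-dimensional Hilbert space $\mathcal{H}$. Write $T\in\mathfrak{B}(\ell^2(X)\otimes\mathcal{H})$ as a matrix $[T(x,y)]_{x,y\in X}$ with $T(x,y)\in\mathfrak{B}(\mathcal{H})$. $T$ has finite propagation if $\{(x,y):T(x,y)\ne0\}$ is an entourage, and is locally compact if every $T(x,y)$ is compact. $\mathbb{C}[X]$ is the $*$-algebra of locally compact finite propagation operators and $C^*(X)$ is its norm closure. Coarse groupoid: $\beta X$ is the Stone–Čech compactification of the discrete set $X$. $G(X)=\bigcup_{r\ge0}\overline{E_r}^{\beta(X\times X)}\subseteq\beta(X\times X)$; the maps $r(x,y)=x$, $s(x,y)=y$ extend continuously to $r,s:G(X)\to\beta X$; $(r,s):G(X)\to\beta X\times\beta X$ is injective and $G(X)$ carries the groupoid structure induced from the pair groupoid, making it a locally compact Hausdorff étale groupoid with unit space $\beta X$. $U\subseteq\beta X$ is invariant if every $\gamma\in G(X)$ with $s(\gamma)\in U$ has $r(\gamma)\in U$. Amenability and partial property A: a locally compact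 Hausdorff étale groupoid $G$ is amenable if for every $\varepsilon>0$ and compact $K\subseteq G$ there is $f\in C_c(G)$ with values in $[0,\infty)$ such that for all $\gamma\in K$, $|\sum_{\alpha\in G_{r(\gamma)}}f(\alpha)-1|<\varepsilon$ and $\sum_{\alpha\in G_{r(\gamma)}}|f(\alpha)-f(\alpha\gamma)|<\varepsilon$, where $G_x=s^{-1}(x)$. For an invariant open $U\subseteq\beta X$, $X$ has partial property A towards $\beta X\setminus U$ if the groupoid $G(X)_{\beta X\setminus U}=s^{-1}(\beta X\setminus U)$ is amenable. Maximal rank distribution: a rank function is a function $\alpha:X\times X\to\mathbb{Z}_{\ge0}$ whose support $\mathrm{supp}(\alpha)=\{(x,y):\alpha(x,y)\neq 0\}$ is an entourage; $\mathcal{R}_{\max}(U)$ is the set of all rank functions $\alpha$ with $\overline{r(\mathrm{supp}(\alpha))}\subseteq U$ (closure in $\beta X$). Truncations: a compact operator $S$ on $\mathcal{H}$ has a singular value decomposition $S=\sum_i\lambda_i(S)\,u_i\otimes v_i$, with $(u\otimes v)x=\langle x,v\rangle u$, and for $\varepsilon>0$ its $\varepsilon$-truncation is $S_\varepsilon=\sum_{i:\lambda_i(S)\ge\varepsilon}\lambda_i(S)u_i\otimes v_i$. For $T\in C^*(X)$, $T_\varepsilon$ is the operator with entries $T_\varepsilon(x,y)=T(x,y)_\varepsilon$. If all entries of $T$ have finite rank, $\mathrm{RANK}(T)(x,y)=\mathrm{rank}(T(x,y))$. Ideals associated to $\mathcal{R}$: $I(\mathcal{R})$ is the norm closure of $C_{\mathcal{R}}=\{T\in\mathbb{C}[X]: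 T(x,y)\text{ has finite rank for all }x,y,\ \mathrm{RANK}(T)\in\mathcal{R}\}$; $\tilde I(\mathcal{R})=\{T\in C^*(X):\mathrm{RANK}(T_\varepsilon)\in\mathcal{R}\text{ for all }\varepsilon>0\}$. *)

(* Defs.v *)
From HB Require Import structures.
From mathcomp Require Import all_boot all_order all_algebra.
From mathcomp Require Import complex.
From mathcomp Require Import all_classical all_reals all_analysis.
From mathcomp Require Import ring lra.

Set Implicit Arguments.
Unset Strict Implicit.
Unset Printing Implicit Defensive.

Import Order.TTheory GRing.Theory Num.Theory.
Import numFieldNormedType.Exports.

Local Open Scope classical_set_scope.
Local Open Scope ring_scope.
Local Open Scope complex_scope.

(* The Stone-Cech compactification of the discrete set X, realised as the space
   of ultrafilters on X; see beta_universal. *)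
Record beta (X : Type) := Beta {
  beta_sets :> set X -> Prop;
  beta_ultra :: UltraFilter beta_sets }.

HB.instance Definition _ (X : Type) := gen_eqMixin (beta X).
HB.instance Definition _ (X : Type) := gen_choiceMixin (beta X).

Section beta_topology.
Context {X : Type}.
Implicit Types (p q : beta X) (A B : set X).

Definition beta_open A : set (beta X) := [set p | beta_sets p A].

Lemma beta_eqP p q : (forall A, p A -> q A) -> p = q.
Proof.
case: p q => [p pU] [q qU] /= pq; have pq' : q = p by apply: max_filter.
by move: qU; rewrite pq' => qU; congr Beta; exact: Prop_irrelevance.
Qed.

Let beta_cover : \bigcup_(A in [set: set X]) beta_open A = setT.
Proof. by apply/seteqP; split => // p _; exists setT => //; exact: filterT. Qed.

Let beta_join A B p : setT A -> setT B -> beta_open A p -> beta_open B p ->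
  exists D, [/\ setT D, beta_open D p & beta_open D `<=` beta_open A `&` beta_open B].
Proof.
move=> _ _ pA pB; exists (A `&` B); split => //; first exact: filterI.
by move=> q qAB; split; apply: filterS qAB => x [].
Qed.

HB.instance Definition _ :=
  isBaseTopological.Build (beta X) beta_cover beta_join.

Lemma open_beta A : open (beta_open A).
Proof. by exists [set A] => //; rewrite bigcup_set1. Qed.

Lemma nbhs_betaP p (W : set (beta X)) :
  nbhs p W <-> exists2 A, p A & beta_open A `<=` W.
Proof.
split; last first.
  by move=> [A pA AW]; apply: filterS AW _; apply: open_nbhs_nbhs; split => //;
    exact: open_beta.
rewrite nbhsE => -[_ [[D _ <-] [A DA pA]] DW]; exists A => //.
by move=> q qA; apply: DW; exists A.
Qed.

Lemma beta_setC p A : p (~` A) <-> ~ p A.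
Proof.
split=> [pnA pA|].
  by have /filter_ex[x []] : p (A `&` ~` A) by exact: filterI.
by have [|//] := in_ultra_setVsetC A (beta_ultra p).
Qed.

Definition beta_pt (x : X) : beta X := Beta (principal_filter_ultra x).


Lemma beta_compact : compact [set: beta X].
Proof.
rewrite compact_ultra => F FU _.
have pU : UltraFilter [set A : set X | F (beta_open A)].
  have PF : ProperFilter [set A : set X | F (beta_open A)].
    apply: Build_ProperFilter_ex.
      move=> A; rewrite /= => FA.
      have [p pA] := filter_ex FA.
      exact: (filter_ex (F := beta_sets p) pA).
    split; rewrite /=.
    - by apply: (filterS _ filterT) => q _; exact: filterT.
    - move=> A B /= FA FB; apply: (@filterS _ F _ _ _ _ (filterI FA FB)) => q [qA qB].
      exact: filterI.
    - by move=> A B AB /=; apply: filterS => q; exact: filterS.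
  split => // G GF FG; apply/seteqP; split => // A GA.
  have [//|FnA] := in_ultra_setVsetC (beta_open A) FU.
  have /FG GnA : F (beta_open (~` A)).
    by apply: filterS FnA => q qA; apply/beta_setC.
  by have /filter_ex[x []] : G (A `&` ~` A) by exact: filterI.
exists (Beta pU); split => // W /nbhs_betaP[A /= FA AW].
exact: filterS FA.
Qed.

Lemma beta_hausdorff : hausdorff_space (beta X).
Proof.
move=> p q pq; apply: beta_eqP => A pA; apply: contrapT => /beta_setC qA.
have [] := pq (beta_open A) (beta_open (~` A)).
- by apply/nbhs_betaP; exists A.
- by apply/nbhs_betaP; exists (~` A).
by move=> t [tA /beta_setC].
Qed.

Lemma beta_pt_dense : dense (range beta_pt).
Proof.
move=> W [p Wp] oW.
have /nbhs_betaP[A /filter_ex[x Ax] AW] : nbhs p W by exact: open_nbhs_nbhs.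
by exists (beta_pt x); split; [apply: AW; exact/principal_filterP|exists x].
Qed.

End beta_topology.

Section beta_map.
Context {X Y : Type} (f : X -> Y).

#[global] Instance beta_map_ultra (p : beta X) : UltraFilter (fmap f p).
Proof.
split=> [|G GF fG]; first exact: fmap_proper_filter.
apply/seteqP; split => // A GA.
have [//|] := in_ultra_setVsetC (f @^-1` A) (beta_ultra p).
move=> /(fG (~` A)) GnA.
by have /filter_ex[x []] : G (A `&` ~` A) by exact: filterI.
Qed.

(* The continuous extension beta X -> beta Y of f : X -> Y. *)
Definition beta_map (p : beta X) : beta Y := Beta (beta_map_ultra p).

Lemma beta_map_continuous : continuous beta_map.
Proof.
move=> p W /nbhs_betaP[A pA AW]; apply/nbhs_betaP; exists (f @^-1` A) => //.
by move=> q qA; exact: AW.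
Qed.

Lemma beta_map_pt x : beta_map (beta_pt x) = beta_pt (f x).
Proof. by apply: beta_eqP => A /principal_filterP Ax; exact/principal_filterP. Qed.

End beta_map.

Lemma beta_universal (X : Type) (K : topologicalType) (f : X -> K) :
  hausdorff_space K -> compact [set: K] ->
  exists! g : beta X -> K, continuous g /\ forall x, g (beta_pt x) = f x.
Proof.
move=> hK cK.
have lim_ex (p : beta X) : exists k : K, fmap f p --> k.
  have := cK; rewrite compact_ultra.
  by move=> /(_ (fmap f p) _ filterT)[k [_ pk]]; exists k.
pose g p := projT1 (cid (lim_ex p)).
have gP p : fmap f (p : beta X) --> g p by exact: projT2 (cid (lim_ex p)).
have uniq (h : beta X -> K) (p : beta X) : continuous h -> (forall x, h (beta_pt x) = f x) ->
    fmap f p --> h p.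
  move=> ch hf W /ch/nbhs_betaP[A pA AW]; apply: filterS pA => x Ax /=.
  by rewrite -hf; apply: AW; exact/principal_filterP.
exists g; split; [split|].
- move=> p W Wgp.
  have [V nV VW] := compact_regular hK cK filterT Wgp.
  apply/nbhs_betaP; exists (f @^-1` V); first exact: gP.
  move=> q qV; apply: VW => N nN.
  have [x [Vx Nx]] : f @^-1` V `&` f @^-1` N !=set0.
    by apply: (@filter_ex _ q); apply: filterI => //; exact: gP.
  by exists (f x).
- move=> x; apply: (cvg_unique hK (F := fmap f (beta_pt x))); first exact: gP.
  by move=> W /nbhs_singleton Wfx; exact: (proj2 (principal_filterP _ _) Wfx).
- move=> h [ch hf]; apply/funext => p.
  by apply: (cvg_unique hK (F := fmap f p)); [exact: gP|exact: uniq].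
Qed.

(* The inner product is linear in its first argument. *)
HB.mixin Record isHilbert (R : realType) H & CompleteNormedModule R[i] H := {
  inner : {dot H for (@Num.conj R[i])} ;
  innerE : forall u, inner u u = `|u| ^+ 2
}.
#[short(type="hilbertType")]
HB.structure Definition Hilbert (R : realType) :=
  {H of CompleteNormedModule R[i] H & isHilbert R H}.

Section cnorm.
Context {R : realType} {V : normedModType R[i]}.
Implicit Types u v : V.

Definition cnorm v : R := complex.Re `|v|.

Lemma cnormE v : `|v| = (cnorm v)%:C.
Proof.
have := normr_ge0 v; rewrite /cnorm; case: `|v| => a b /=.
by rewrite lecE /= => /andP[/eqP -> _].
Qed.

Lemma cnorm_ge0 v : 0 <= cnorm v.
Proof. by rewrite -lecR -cnormE; exact: normr_ge0. Qed.

Lemma cnorm0 : cnorm (0 : V) = 0.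
Proof. by rewrite /cnorm normr0. Qed.

Lemma cnorm_eq0 v : cnorm v = 0 -> v = 0.
Proof. by move=> v0; apply/normr0_eq0; rewrite cnormE v0. Qed.

Lemma cnormD u v : cnorm (u + v) <= cnorm u + cnorm v.
Proof. by rewrite -lecR rmorphD/= -!cnormE ler_normD. Qed.

Lemma cnormZ (a : R[i]) v : cnorm (a *: v) = complex.Re `|a| * cnorm v.
Proof.
rewrite {1}/cnorm normrZ cnormE.
by case: `|a| => b c /=; rewrite mulr0 subr0.
Qed.

End cnorm.

Section ell2.
Context {R : realType} (X : choiceType) (V : normedModType R[i]).
Implicit Types f g : X -> V.
Local Open Scope ereal_scope.

Definition ell2sum f : \bar R := \esum_(x in [set: X]) ((cnorm (f x)) ^+ 2)%:E.

Definition is_ell2 : {pred X -> V} := [pred f | ell2sum f < +oo].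

Lemma ell2sum_ge0 f : 0 <= ell2sum f.
Proof. by apply: esum_ge0 => x _; rewrite lee_fin sqr_ge0. Qed.

Lemma ell2_fin_num f : f \in is_ell2 -> ell2sum f \is a fin_num.
Proof. by move=> fl; rewrite ge0_fin_numE ?ell2sum_ge0. Qed.

Let esumZ_le (c : R) (a : X -> \bar R) : (0 <= c)%R -> (forall x, 0 <= a x) ->
  \esum_(x in [set: X]) (c%:E * a x) <= c%:E * \esum_(x in [set: X]) a x.
Proof.
move=> c0 a0; apply: ub_ereal_sup => _ [F [finF _] <-].
rewrite -ge0_mule_fsumr//; apply: lee_wpmul2l; rewrite ?lee_fin//.
by apply: esum_ge; exists F.
Qed.

Lemma ell2sumD (t : R) f g : (0 < t)%R ->
  ell2sum (f + g)%R <= (1 + t)%:E * ell2sum f + (1 + t^-1)%:E * ell2sum g.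
Proof.
move=> t0; have t0' : (0 <= t^-1)%R by rewrite invr_ge0 ltW.
apply: (@le_trans _ _ (\esum_(x in [set: X])
   ((1 + t)%:E * ((cnorm (f x)) ^+ 2)%:E + (1 + t^-1)%:E * ((cnorm (g x)) ^+ 2)%:E))).
  apply: le_esum => x _; rewrite -!EFinM -EFinD lee_fin.
  apply: (@le_trans _ _ ((cnorm (f x) + cnorm (g x)) ^+ 2)%R).
    by rewrite ler_sqr ?nnegrE ?addr_ge0 ?cnorm_ge0// cnormD.
  rewrite -subr_ge0.
  have -> : ((1 + t) * cnorm (f x) ^+ 2 + (1 + t^-1) * cnorm (g x) ^+ 2 -
      (cnorm (f x) + cnorm (g x)) ^+ 2 =
      t * (cnorm (f x) - t^-1 * cnorm (g x)) ^+ 2)%R.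
    by field; rewrite gt_eqF.
  by rewrite mulr_ge0 ?sqr_ge0// ltW.
rewrite esumD; last 2 first.
- by move=> x _; rewrite -EFinM lee_fin mulr_ge0 ?sqr_ge0// addr_ge0// ltW.
- by move=> x _; rewrite -EFinM lee_fin mulr_ge0 ?sqr_ge0// addr_ge0.
apply: leeD; apply: esumZ_le.
- by rewrite addr_ge0// ltW.
- by move=> x; rewrite lee_fin sqr_ge0.
- by rewrite addr_ge0.
- by move=> x; rewrite lee_fin sqr_ge0.
Qed.

Lemma ell2sumZ_le (a : R[i]) f :
  ell2sum (a *: f)%R <= ((complex.Re `|a|) ^+ 2)%:E * ell2sum f.
Proof.
apply: le_trans (esumZ_le _ _); rewrite ?sqr_ge0//; last first.
  by move=> x; rewrite lee_fin sqr_ge0.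
by apply: le_esum => x _; rewrite cnormZ exprMn.
Qed.

Lemma ell2_submod_closed : submod_closed is_ell2.
Proof.
split=> [|a f g /=]; rewrite !inE.
  rewrite /ell2sum esum1 ?ltry// => x _.
  by rewrite cnorm0 expr0n.
move=> fl gl; apply: le_lt_trans (ell2sumD (a *: f)%R g ltr01) _.
apply: lte_add_pinfty; apply: lte_mul_pinfty;
  rewrite ?lee_fin ?addr_ge0 ?invr_ge0//.
by apply: le_lt_trans (ell2sumZ_le a f) _; apply: lte_mul_pinfty; rewrite ?lee_fin ?sqr_ge0.
Qed.
HB.instance Definition _ := GRing.isSubmodClosed.Build _ _ is_ell2 ell2_submod_closed.

(* ell2 X V with V a Hilbert space H stands for the Hilbert tensor product
   of l^2(X) and H, via the identification of (delta_x (x) v) with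
   (ell2_delta x v). *)
Record ell2 := Ell2 { ell2_fun :> X -> V ; ell2P : ell2_fun \in is_ell2 }.
HB.instance Definition _ := [isSub for ell2_fun].
HB.instance Definition _ := [Choice of ell2 by <:].
HB.instance Definition _ := [SubChoice_isSubLmodule of ell2 by <:].
End ell2.

Section ell2_norm.
Context {R : realType} {X : choiceType} {V : normedModType R[i]}.
Implicit Types f g : ell2 X V.

Definition ell2norm f : R := Num.sqrt (fine (ell2sum f)).

Lemma ell2norm_ge0 f : 0 <= ell2norm f. Proof. exact: sqrtr_ge0. Qed.

Lemma ell2sumE f : ell2sum f = (ell2norm f ^+ 2)%:E.
Proof.
rewrite sqr_sqrtr ?fine_ge0 ?ell2sum_ge0// fineK//.
exact/ell2_fin_num/ell2P.
Qed.

Lemma ell2_eq f g : f =1 g -> f = g.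
Proof. by move=> fg; apply/val_inj/funext. Qed.

Lemma ell2norm_le (c : R) f : 0 <= c ->
  (ell2sum f <= (c ^+ 2)%:E)%E -> ell2norm f <= c.
Proof.
by move=> c0; rewrite ell2sumE lee_fin ler_sqr ?nnegrE ?ell2norm_ge0.
Qed.

Lemma ell2norm_eq0 f : ell2norm f = 0 -> f = 0.
Proof.
move=> f0; apply: ell2_eq => x; apply: cnorm_eq0; apply/eqP.
rewrite -sqrf_eq0 eq_le sqr_ge0 andbT -lee_fin.
have := ell2sumE f; rewrite f0 expr0n/= => <-.
apply: esum_ge; exists [set x]; first by split => //; exact: finite_set1.
by rewrite fsbig_set1.
Qed.

Lemma ell2normZ_le (a : R[i]) f : ell2norm (a *: f) <= complex.Re `|a| * ell2norm f.
Proof.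
apply: ell2norm_le.
  by rewrite mulr_ge0 ?ell2norm_ge0// normc_def sqrtr_ge0.
by rewrite exprMn EFinM -ell2sumE; exact: ell2sumZ_le.
Qed.

Lemma ell2normZ (a : R[i]) f : ell2norm (a *: f) = complex.Re `|a| * ell2norm f.
Proof.
apply/eqP; rewrite eq_le ell2normZ_le/=.
have [->|a0] := eqVneq a 0; first by rewrite Normc.normc0 mul0r ell2norm_ge0.
have ra : 0 < Normc.normc a.
  have : 0 < `|a| by rewrite normr_gt0.
  by rewrite ltcR.
have := ell2normZ_le a^-1 (a *: f).
rewrite scalerA mulVf// scale1r /= Normc.normcV.
by rewrite ler_pdivlMl.
Qed.

Lemma ell2normD f g : ell2norm (f + g) <= ell2norm f + ell2norm g.
Proof.
have [f0|f0] := eqVneq (ell2norm f) 0.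
  by rewrite (ell2norm_eq0 f0) add0r lerDr ell2norm_ge0.
have [g0|g0] := eqVneq (ell2norm g) 0.
  by rewrite (ell2norm_eq0 g0) addr0 lerDl ell2norm_ge0.
have fp : 0 < ell2norm f by rewrite lt_neqAle eq_sym f0 ell2norm_ge0.
have gp : 0 < ell2norm g by rewrite lt_neqAle eq_sym g0 ell2norm_ge0.
apply: ell2norm_le; first by rewrite addr_ge0 ?ell2norm_ge0.
apply: le_trans (ell2sumD f g (divr_gt0 gp fp)) _.
rewrite !ell2sumE -!EFinM -EFinD lee_fin le_eqVlt; apply/orP; left; apply/eqP.
by field; rewrite f0 g0.
Qed.

Lemma ell2norm_subproofZ (a : R[i]) f :
  (ell2norm (a *: f))%:C = `|a| * (ell2norm f)%:C.
Proof. by rewrite ell2normZ rmorphM. Qed.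

Lemma ell2norm_subproofD f g :
  (ell2norm (f + g))%:C <= (ell2norm f)%:C + (ell2norm g)%:C.
Proof. by rewrite -rmorphD lecR ell2normD. Qed.

Lemma ell2norm_subproof0 f : (ell2norm f)%:C = 0 -> f = 0.
Proof. by case=> /ell2norm_eq0. Qed.

HB.instance Definition _ := Lmodule_isNormed.Build R[i] (ell2 X V)
  ell2norm_subproofD ell2norm_subproofZ ell2norm_subproof0.

Lemma ell2_normE f : `|f| = (ell2norm f)%:C. Proof. by []. Qed.

Fact ell2_delta_subproof (x : X) (v : V) :
  (fun y => if y == x then v else 0) \in is_ell2 (V := V).
Proof.
rewrite inE /= /ell2sum (_ : esum _ _ =
    \esum_(y in [set x]) ((cnorm v) ^+ 2)%:E)%E; last first.
  rewrite [RHS]esum_mkcond; apply: eq_esum => y _.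
  by rewrite in_set1; case: eqP => // _; rewrite cnorm0 expr0n.
by rewrite esum_set1 ?ltry// lee_fin sqr_ge0.
Qed.

Definition ell2_delta (x : X) (v : V) : ell2 X V := Ell2 (ell2_delta_subproof x v).

End ell2_norm.

Section coarse.
Context {R : realType} (X : metricType R).

Definition bounded_geometry := forall r : R, 0 < r ->
  exists N : nat, forall x : X, (ball x r #<= `I_N)%card.

(* The entourages of the coarse structure of X; not to be confused with the
   (uniform) entourages of the library. *)
Definition coarse_entourage (E : set (X * X)) :=
  exists M : R, forall xy, E xy -> mdist xy.1 xy.2 <= M.

Definition tube (r : R) : set (X * X) := [set xy | mdist xy.1 xy.2 <= r].

End coarse.
Arguments tube {R} X r _.

(* The part of the structure of an etale groupoid that enters the definition
   of amenability. The product gmul is only meaningful on composable pairs,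
   i.e. when gsrc a = grng b. *)
Record groupoid_data := GroupoidData {
  garrow :> topologicalType ;
  gunit : topologicalType ;
  grng : garrow -> gunit ;
  gsrc : garrow -> gunit ;
  gmul : garrow -> garrow -> garrow }.
Arguments grng {g}.
Arguments gsrc {g}.
Arguments gmul {g}.

Section groupoid.
Variable G : groupoid_data.

Definition invariant_units (U : set (gunit G)) :=
  forall a : G, U (gsrc a) -> U (grng a).

Definition gfiber (x : gunit G) : set G := [set a | gsrc a = x].

(* The reduction to an invariant set F of units has arrows s^-1(F). Its units
   are kept inside those of G, as they only serve to index the fibres. *)
Definition reduction (F : set (gunit G)) : groupoid_data :=
  @GroupoidData (set_type [set a : G | F (gsrc a)]) (gunit G)
    (fun a => grng (\val a)) (fun a => gsrc (\val a))
    (fun a b => insubd a (gmul (\val a) (\val b))).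

Definition amenable (R : realType) :=
  forall (e : R) (K : set G), 0 < e -> compact K ->
  exists f : G -> R,
    [/\ continuous f,
        compact (closure [set a | f a != 0]),
        forall a, 0 <= f a &
        forall c, K c ->
          (`| \esum_(a in gfiber (grng c)) (f a)%:E - 1 | < e%:E)%E /\
          (\esum_(a in gfiber (grng c)) `| f a - f (gmul a c) |%:E < e%:E)%E].

End groupoid.

Section coarse_groupoid.
Context {R : realType} (X : metricType R).

Definition coarse_arrows : set (beta (X * X)) :=
  \bigcup_(r in [set r : R | 0 <= r]) closure (beta_pt @` tube X r).

(* In the pair groupoid (x, y)(y, z) = (x, z). As (r, s) is injective on G(X)
   when X has bounded geometry, the product of a composable pair (a, b) is the
   unique arrow c with r(c) = r(a) and s(c) = s(b). *)
Definition coarse_groupoid : groupoid_data :=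
  let rng (a : set_type coarse_arrows) : beta X := beta_map fst (\val a) in
  let src (a : set_type coarse_arrows) : beta X := beta_map snd (\val a) in
  @GroupoidData (set_type coarse_arrows) (beta X) rng src
    (fun a b => xget a [set c | rng c = rng a /\ src c = src b]).

Definition partial_property_A (U : set (beta X)) :=
  amenable (@reduction coarse_groupoid (~` U)) R.

Definition rank_support (alpha : X * X -> nat) : set (X * X) :=
  [set xy | alpha xy != 0%N].

Definition Rmax (U : set (beta X)) : set (X * X -> nat) :=
  [set alpha | coarse_entourage (rank_support alpha) /\
     closure (beta_pt @` (fst @` rank_support alpha)) `<=` U].

End coarse_groupoid.

Section operators.
Context {R : realType}.

Definition opnorm_le (V W : normedModType R[i]) (T : V -> W) (c : R) :=
  forall v, `|T v| <= c%:C * `|v|.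

Record bounded_op (V W : normedModType R[i]) := BoundedOp {
  op_linear :> {linear V -> W} ;
  op_bounded : exists c, opnorm_le op_linear c }.

Definition op_closure (V W : normedModType R[i]) (A : set (bounded_op V W)) :
    set (bounded_op V W) :=
  [set T | forall e : R, 0 < e ->
     exists2 S, A S & opnorm_le (fun v => T v - S v) e].

Definition compact_op (V W : normedModType R[i]) (S : V -> W) :=
  precompact (S @` [set v | `|v| <= 1]).

Definition lin_span (V : lmodType R[i]) n (b : 'I_n -> V) : set V :=
  [set \sum_i c i *: b i | c in [set: 'I_n -> R[i]]].

Definition lin_indep (V : lmodType R[i]) n (b : 'I_n -> V) :=
  forall c : 'I_n -> R[i], \sum_i c i *: b i = 0 -> forall i, c i = 0.

Definition infinite_dimensional (V : lmodType R[i]) :=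
  ~ exists n (b : 'I_n -> V), lin_span b = setT.

Definition separable (V : topologicalType) :=
  exists D : set V, countable D /\ dense D.

Definition has_rank (V W : lmodType R[i]) (S : V -> W) (n : nat) :=
  exists b : 'I_n -> W, lin_indep b /\ range S = lin_span b.

Definition finite_rank (V W : lmodType R[i]) (S : V -> W) :=
  exists n, has_rank S n.

Definition rank (V W : lmodType R[i]) (S : V -> W) : nat :=
  xget 0%N (has_rank S).

End operators.

Section svd.
Context {R : realType} {H : hilbertType R}.
Implicit Types (S : H -> H) (l : nat -> R) (u v : nat -> H).

Definition rank_one (u v : H) : H -> H := fun x => inner x v *: u.

(* S is the sum of the l_i (u_i (x) v_i). When S has finite rank all but
   finitely many l_i vanish, and the corresponding u_i and v_i are irrelevant. *)
Definition is_svd S l u v :=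
  [/\ (forall i, 0 <= l i) /\ l @ \oo --> (0 : R),
      forall i j, l i != 0 -> l j != 0 -> inner (u i) (u j) = (i == j)%:R,
      forall i j, l i != 0 -> l j != 0 -> inner (v i) (v j) = (i == j)%:R &
      forall x, (fun n => \sum_(i < n) (l i)%:C *: rank_one (u i) (v i) x) @ \oo
                --> S x].

(* For S compact the result does not depend on the singular value decomposition
   that is chosen. *)
Definition truncation (e : R) S : H -> H :=
  xget S [set S' | exists l u v, is_svd S l u v /\
    S' = fun x => \sum_(i \in [set i | e <= l i])
                    (l i)%:C *: rank_one (u i) (v i) x].

End svd.

Section roe.
Context {R : realType} (X : metricType R) (H : hilbertType R).

Definition roe_op := bounded_op (ell2 X H) (ell2 X H).

Definition entry (T : roe_op) (x y : X) : H -> H :=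
  fun v => T (ell2_delta y v) x.

Definition finite_propagation (T : roe_op) :=
  coarse_entourage [set xy | entry T xy.1 xy.2 <> (fun=> 0)].

Definition locally_compact_op (T : roe_op) :=
  forall x y, compact_op (entry T x y).

Definition algebraic_roe : set roe_op :=
  [set T | finite_propagation T /\ locally_compact_op T].

Definition roe_algebra : set roe_op := op_closure algebraic_roe.

Definition RANK (t : X -> X -> H -> H) : X * X -> nat :=
  fun xy => rank (t xy.1 xy.2).

Definition truncated_entry (e : R) (T : roe_op) (x y : X) : H -> H :=
  truncation e (entry T x y).

Variable D : set (X * X -> nat).

Definition rank_ideal : set roe_op :=
  op_closure [set T | [/\ algebraic_roe T,
    forall x y, finite_rank (entry T x y) & D (RANK (entry T))]].

Definition rank_ideal_tilde : set roe_op :=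
  [set T | roe_algebra T /\
     forall e : R, 0 < e -> D (RANK (truncated_entry e T))].

End roe.
Arguments rank_ideal {R X} H D _.
Arguments rank_ideal_tilde {R X} H D _.

(* Main.v *)
(** If T is within e/2 of some W in C_R, every entry of T surviving the
e-truncation has norm at least e, so W is nonzero there; this gives
I(R) <= I~(R).

Conversely, amenability of the groupoid over the complement of U gives a
function on the arrows which, extended to beta (X * X) and restricted to X * X,
is a kernel g of finite propagation. Its columns are almost normalised and
almost invariant outside some D whose closure is contained in U: otherwise an
ultrafilter of bad points would produce an arrow violating amenability. The Schur
multiplier Phi with kernel <sqrt g_x, sqrt g_y>, cut down to the complement of D,
is uniformly bounded and has finite propagation. If T lies in I~(R) and T' has
finite propagation and is close to T, then Phi T is close to Phi T', hence to the
part of T' outside D; the remaining part of T' is supported near D, and by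
invariance a neighbourhood of D still has closure in U. Truncating Phi T and that
remaining part entrywise costs little, because both have finite propagation, and
yields an element of C_R. *)
Require Import Defs.
From HB Require Import structures.
From mathcomp Require Import all_boot all_order all_algebra.
From mathcomp Require Import finmap complex.
From mathcomp Require Import all_classical all_reals all_analysis.
From mathcomp Require Import ring lra.

Set Implicit Arguments.
Unset Strict Implicit.
Unset Printing Implicit Defensive.

Import Order.TTheory GRing.Theory Num.Theory.
Import numFieldNormedType.Exports.

Local Open Scope classical_set_scope.
Local Open Scope ring_scope.
Local Open Scope complex_scope.

(** * The coarse groupoid *)

(** The order in which the constants are fixed is what makes the second inclusion work. [T] itself
    need not have finite propagation, so truncating its entries may cost an uncontrolled amount in
    norm: entrywise errors add up over balls. Multiplication by the kernel cuts the propagation down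
    to 2 S, but S comes from amenability and grows with the accuracy demanded of the kernel. The
    circle is avoided because that accuracy depends only on T', on its norm and on the size of balls
    of its propagation R0, while the truncation level is chosen after S, which is possible since
    membership in I~(R) speaks of all levels. It also matters that the bound on Phi involves only
    the l^2 norms of the columns of sqrt g, and not S.

    The definition of amenability speaks of sums over fibres of arrows, the kernel of sums over
    balls. A finite coloring of X that is injective on balls indexes both by the same finite set of
    colors, so that they can be compared term by term along an ultrafilter. *)

Section beta_facts.
Context {X : Type}.
Implicit Types (p : beta X) (A B : set X).

Lemma beta_ptP x A : beta_pt x A <-> A x.
Proof. exact: principal_filterP. Qed.

Lemma beta_pt_cvg p : fmap beta_pt (p : beta X) --> p.
Proof.
move=> W /nbhs_betaP[A pA AW].
by apply: (@filterS _ p _ _ _ _ pA) => x Ax; apply: AW; exact/beta_ptP.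
Qed.

Lemma closure_beta_pt A : closure (beta_pt @` A) = beta_open A.
Proof.
apply/seteqP; split=> p pA.
  apply: contrapT => /beta_setC pnA.
  have [] := pA (beta_open (~` A)); first by apply/nbhs_betaP; exists (~` A).
  by move=> _ [[x Ax <-]] /beta_ptP.
move=> W /nbhs_betaP[B pB BW].
have [x [Ax Bx]] : A `&` B !=set0 by apply: (@filter_ex _ p); exact: filterI.
by exists (beta_pt x); split; [exists x|apply: BW; exact/beta_ptP].
Qed.

Lemma closed_beta_open A : closed (beta_open A).
Proof. by rewrite -closure_beta_pt; exact: closed_closure. Qed.

Lemma beta_setU p A B : p (A `|` B) -> p A \/ p B.
Proof.
move=> pAB; have [|pnA] := pselect (p A); first by left.
right; move/beta_setC: pnA => pnA.
by apply: (filterS _ (filterI pAB pnA)) => x [[]].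
Qed.

(** Were no color class in [p], removing the classes one at a time would leave
    [[set x | (n <= k x)%N]] in [p] for every n, and this set is empty at n = N. *)
Lemma beta_finite_cover p (N : nat) (k : X -> nat) : (forall x, (k x < N)%N) ->
  exists i, p [set x | k x = i].
Proof.
move=> kN; apply: contrapT => /forallNP nk.
suff: forall n, p [set x | (n <= k x)%N].
  by move=> /(_ N) /filter_ex[x /=]; rewrite leqNgt kN.
elim=> [|n IH]; first by apply: (filterS _ filterT).
move/beta_setC : (nk n) => nkn.
apply: (filterS _ (filterI IH nkn)) => x [/= nx kx].
by rewrite ltn_neqAle nx andbT eq_sym; exact/eqP.
Qed.

End beta_facts.

(** * Balls and colorings in bounded geometry *)

Section balls.
Context {R : realType} (X : metricType R).

(** Balls as duplicate-free lists make sums over them finite [\sum]s. The bound [N] is uniform in x;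
    through it bounded geometry enters the norm estimates. *)
Definition is_ball_enum (r : R) (N : nat) (b : X -> seq X) := forall x,
  [/\ uniq (b x), forall y, (y \in b x) = (mdist x y <= r) & (size (b x) <= N)%N].

Hypothesis bgX : bounded_geometry X.

Lemma bounded_geometry_balls (r : R) :
  exists (N : nat) (b : X -> seq X), is_ball_enum r N b.
Proof.
wlog r0 : r / 0 <= r => [H|].
  have [/H//|r0] := leP 0 r.
  exists 0%N, (fun=> [::]) => x; split => // y.
  by apply/esym/negbTE; rewrite -ltNge (lt_le_trans r0)// mdist_ge0.
(* [bounded_geometry] bounds open balls while the lists enumerate closed ones, hence the larger
   radius. *)
have [|N HN] := bgX (r := r + 1); first by rewrite ltr_wpDl.
have HN' (x : X) : ([set y : X | mdist x y <= r] #<= `I_N)%card.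
  apply: card_le_trans (HN x); apply: subset_card_le => y /= xy.
  by rewrite ballEmdist/= (le_lt_trans xy)// ltrDl.
have fin (x : X) : finite_set [set y : X | mdist x y <= r].
  by apply: (card_le_finite (HN' x)); exact: finite_II.
exists N, (fun x => enum_fset (fset_set [set y : X | mdist x y <= r])) => x.
split; first exact: fset_uniq.
  by move=> y; rewrite in_fset_set//; apply/idP/idP => [/set_mem|yr]//; exact/mem_set.
exact: geq_card_fset_set.
Qed.

(** Greedy coloring: each color is a maximal r-separated subset of the points not yet colored. A
    point left over after N rounds would, by maximality, have a point of each of the N disjoint
    layers within r; together with itself these are N + 1 points in a ball that holds at most N. *)
Lemma bounded_geometry_coloring (r : R) : exists (N : nat) (k : X -> nat),
  (forall x, (k x < N)%N) /\
  forall x y, mdist x y <= r -> k x = k y -> x = y.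
Proof.
have [r0|r0] := leP 0 r; last first.
  exists 1%N, (fun=> 0%N); split => // x y xy.
  by have := le_lt_trans (le_trans (mdist_ge0 x y) xy) r0; rewrite ltxx.
have [N [b bP]] := bounded_geometry_balls r.
pose sep (A B : set X) := B `<=` A /\
  forall x y, B x -> B y -> mdist x y <= r -> x = y.
have max A : exists B, sep A B /\ forall x, A x -> exists2 y, B y & mdist x y <= r.
  have [|B [BA Bmax]] := @Zorn_bigcup X (sep A).
    move=> F Fsep Ftot; split.
      by move=> x [B FB Bx]; exact: (Fsep _ FB).1.
    move=> x y [B FB Bx] [C FC Cy].
    have [BC|CB] := Ftot _ _ FB FC.
      by apply: (Fsep _ FC).2 => //; exact: BC.
    by apply: (Fsep _ FB).2 => //; exact: CB.
  exists B; split => // x Ax; apply: contrapT => nx.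
  have nBx : ~ B x by move=> Bx; apply: nx; exists x => //; rewrite mdistxx.
  have nx' y : B y -> mdist x y <= r -> False by move=> By xy; apply: nx; exists y.
  apply: (Bmax (B `|` [set x])).
    split; first by move=> y; left.
    by move=> /(_ x) BB; apply: nBx; apply: BB; right.
  split; first by move=> y [By|->]; [exact: BA.1|].
  move=> y z [By|->] [Bz|->] //.
  - exact: BA.2.
  - by rewrite metric_sym => /(nx' _ By).
  - by move=> /(nx' _ Bz).
pose M A := projT1 (cid (max A)).
have MP A : sep A (M A) /\ forall x, A x -> exists2 y, M A y & mdist x y <= r.
  exact: projT2 (cid (max A)).
pose rem := fix rem n := if n is n'.+1 then rem n' `\` M (rem n') else [set: X].
have remS n : rem n.+1 = rem n `\` M (rem n) by [].
have rem_le m n : (m <= n)%N -> rem n `<=` rem m.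
  elim: n => [|n IH]; first by rewrite leqn0 => /eqP ->.
  rewrite leq_eqVlt => /orP[/eqP->//|]; rewrite ltnS => /IH mn x.
  by rewrite remS => -[/mn].
have Mdis m n x : M (rem m) x -> M (rem n) x -> m = n.
  wlog mn : m n / (m <= n)%N => [H|].
    have [/H//|/ltnW/H {}H] := leqP m n; by move=> *; apply/esym/H.
  move=> Mm /(MP _).1.1 nx; apply/eqP; rewrite eqn_leq mn/= leqNgt.
  by apply/negP => /rem_le /(_ _ nx); rewrite remS => -[].
have remN x : ~ rem N x.
  move=> xN; have bi (i : 'I_N) : exists y, M (rem i) y /\ mdist x y <= r.
    have [|y My xy] := (MP (rem i)).2 x; last by exists y.
    by apply: rem_le xN; exact: ltnW.
  pose y i := projT1 (cid (bi i)).
  have yP (i : 'I_N) : M (rem i) (y i) /\ mdist x (y i) <= r by exact: projT2 (cid (bi i)).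
  have := @uniq_leq_size _ (x :: [seq y i | i <- enum 'I_N]) (b x).
  have [_ bx sz] := bP x.
  rewrite [size (_ :: _)]/= size_map size_enum_ord => H.
  suff: (N < N)%N by rewrite ltnn.
  apply: leq_trans sz; apply: H.
    rewrite cons_uniq; apply/andP; split.
      apply/mapP => -[i _ xi]; have := rem_le i.+1 N (ltn_ord i) x xN.
      by rewrite remS => -[_ /=]; rewrite xi; apply; exact: (yP i).1.
    rewrite map_inj_uniq ?enum_uniq// => i j ij; apply: val_inj => /=.
    by apply: (Mdis _ _ (y i)); [exact: (yP i).1|rewrite ij; exact: (yP j).1].
  move=> z; rewrite inE => /orP[/eqP->|/mapP[i _ ->]]; rewrite bx.
    by have [z' _] := (MP setT).2 x I; rewrite mdistxx; apply: le_trans; exact: mdist_ge0.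
  exact: (yP i).2.
have ex x : exists i, (i < N)%N /\ M (rem i) x.
  apply: contrapT => /forallNP nx; apply: (remN x).
  have : (N <= N)%N by [].
  elim: {1 3}N => [//|n IH] nN; rewrite remS; split; first exact/IH/ltnW.
  by move=> Mx; apply: (nx n).
exists N, (fun x => projT1 (cid (ex x))); split.
  by move=> x; case: cid => i [].
move=> x y xy; case: cid => i [iN Mx] /=; case: cid => j [jN My]/= ij.
by rewrite -ij in My; exact: (MP (rem i)).1.2 Mx My xy.
Qed.

End balls.

Lemma beta_map_comp (X Y Z : Type) (f : X -> Y) (g : Y -> Z) (p : beta X) :
  beta_map g (beta_map f p) = beta_map (g \o f) p.
Proof. exact: beta_eqP. Qed.

Lemma beta_map_id (X : Type) (p : beta X) : beta_map id p = p.
Proof. exact: beta_eqP. Qed.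

(* Serves as the fibre sum of an etale groupoid, the a i being the finitely many
   arrows of a fibre that meet the support. *)
Lemma esum_finite_image (R : realType) (T : choiceType) (D : set T) (N : nat)
    (P : pred 'I_N) (a : 'I_N -> T) (F : T -> R) :
    (forall x, 0 <= F x) -> (forall i, P i -> D (a i)) ->
    (forall i j, P i -> P j -> a i = a j -> i = j) ->
  ((\sum_(i | P i) F (a i))%:E <= \esum_(x in D) (F x)%:E)%E /\
  ((forall x, D x -> F x != 0 -> exists2 i, P i & x = a i) ->
    \esum_(x in D) (F x)%:E = (\sum_(i | P i) F (a i))%:E).
Proof.
move=> F0 PD ainj.
have E0 x : (0 <= (F x)%:E)%E by rewrite lee_fin.
have imE : \esum_(x in a @` [set i | P i]) (F x)%:E = (\sum_(i | P i) F (a i))%:E.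
  rewrite esum_image; last by move=> i j /set_mem Pi /set_mem Pj; exact: ainj.
  rewrite esum_fset//; last exact: finite_finset.
  rewrite -sumEFin (@bigfs _ _ _ _ _ P) ?index_enum_uniq//.
  by move=> j _; rewrite mem_index_enum.
have DI : D `&` (a @` [set i | P i]) = a @` [set i | P i].
  by apply/setIidPr => _ [i Pi <-]; exact: PD.
have := @esumID _ _ (a @` [set i | P i]) D _ (fun x _ => E0 x).
rewrite DI imE => ->; split; first by rewrite leeDl// esum_ge0.
move=> H; rewrite [X in (_ + X)%E]esum1 ?adde0// => x [Dx nx].
congr EFin; apply/eqP/negPn/negP => /(H _ Dx) [i Pi xi]; apply: nx.
by exists i.
Qed.

Section arrows.
Context {R : realType} (X : metricType R).
Hypothesis bgX : bounded_geometry X.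

Lemma coarse_arrowsP (g : beta (X * X)) :
  coarse_arrows (X := X) g <-> exists r, g (tube X r).
Proof.
split=> [[r _]|[r gr]]; first by rewrite closure_beta_pt; exists r.
exists (Num.max r 0) => /=; first by rewrite le_max lexx orbT.
rewrite closure_beta_pt; apply: (filterS _ gr) => xy /= xyr.
by rewrite /tube /= le_max xyr.
Qed.

(* On pairs at distance at most r whose first coordinate has a fixed color,
   snd is injective, so an arrow is determined by its source and that color. *)
Lemma arrow_inj (r : R) (g g' : beta (X * X)) : g (tube X r) -> g' (tube X r) ->
  beta_map fst g = beta_map fst g' -> beta_map snd g = beta_map snd g' -> g = g'.
Proof.
move=> gr gr' gg1 gg2.
(* Two first coordinates paired with the same second one are at most r + r apart. *)
have [N [k [kN kinj]]] := bounded_geometry_coloring bgX (r + r).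
have [i gi] := beta_finite_cover (beta_map fst g) kN.
have gi' : beta_map fst g' [set x | k x = i] by rewrite -gg1.
pose B : set (X * X) := tube X r `&` [set xy | k xy.1 = i].
have gB : g B by apply: filterI.
have gB' : g' B by apply: filterI.
apply: beta_eqP => A gA.
have gAB : g (A `&` B) by apply: filterI.
have : beta_map snd g [set y | exists x, (A `&` B) (x, y)].
  by apply: (filterS _ gAB) => -[x y] ABxy; exists x.
rewrite gg2 => gAB'; apply: (filterS _ (filterI gB' gAB')).
move=> [x y] [[xyr kx]] [x' [Ax [x'yr kx']]] /=.
rewrite (kinj x x')//; last by move: kx kx' => /= -> ->.
apply: le_trans (metric_triangle x y x') _; apply: lerD => //.
by rewrite metric_sym.
Qed.

Lemma coarse_arrow_inj (g g' : beta (X * X)) :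
  coarse_arrows (X := X) g -> coarse_arrows (X := X) g' ->
  beta_map fst g = beta_map fst g' -> beta_map snd g = beta_map snd g' -> g = g'.
Proof.
move=> /coarse_arrowsP[r gr] /coarse_arrowsP[r' gr'].
apply: (@arrow_inj (Num.max r r')).
  by apply: (filterS _ gr) => xy xyr; rewrite /tube/= le_max xyr.
by apply: (filterS _ gr') => xy xyr; rewrite /tube/= le_max xyr orbT.
Qed.

End arrows.

(** * Arrows over a closed set of units *)

Section reduction_facts.
Context {R : realType} (X : metricType R) (F : set (beta X)).
Let G := coarse_groupoid X.
Let GF := @reduction G F.

(* The arrows of the reduction are doubly nested subtypes of beta (X * X). *)
Definition arrow_val (a : GF) : beta (X * X) := \val (\val a).

Lemma arrow_val_inj : injective arrow_val.
Proof. by move=> a b ab; apply: val_inj; exact: val_inj. Qed.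

Lemma arrow_valP (a : GF) : (exists r, arrow_val a (tube X r)) /\ F (beta_map snd (arrow_val a)).
Proof.
split; last exact: (set_mem (valP a)).
by apply/coarse_arrowsP; exact: (set_mem (valP (\val a))).
Qed.

Lemma arrow_val_ex (g : beta (X * X)) (r : R) : g (tube X r) -> F (beta_map snd g) ->
  exists a : GF, arrow_val a = g.
Proof.
move=> gr gF.
have gA : g \in coarse_arrows (X := X) by apply/mem_set/coarse_arrowsP; exists r.
pose a : G := exist _ g gA.
have aF : a \in [set a : G | F (gsrc a)] by apply/mem_set.
by exists (exist _ a aF).
Qed.

Lemma nbhs_arrow_val (a : GF) (A : set GF) :
  nbhs a A <-> exists2 B, arrow_val a B & forall a', arrow_val a' B -> A a'.
Proof.
split.
  rewrite nbhsE => -[V [[V' [V'' oV'' <-] <-] Va] VA].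
  have /nbhs_betaP[B aB BV] : nbhs (arrow_val a) V'' by exact: open_nbhs_nbhs.
  by exists B => // a' a'B; apply: VA; exact: BV.
move=> [B aB BA]; rewrite nbhsE; exists (arrow_val @^-1` beta_open B) => //.
split => //; exists (set_val @^-1` beta_open B) => //.
by exists (beta_open B) => //; exact: open_beta.
Qed.

(** Supplies the compact set to which amenability is applied. An ultrafilter of such arrows has a
    limit in beta (X * X), which is again such an arrow because [beta_open B] and [F] are both
    closed. *)
Lemma compact_arrow_val (B : set (X * X)) (r : R) : closed F -> B `<=` tube X r ->
  compact [set a : GF | arrow_val a B].
Proof.
move=> cF Br; rewrite compact_ultra => W WU WB.
have := @beta_compact (X * X); rewrite compact_ultra.
move=> /(_ _ (beta_map_ultra arrow_val (Beta WU)) filterT)[g [_ gW]].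
have Wg V : nbhs g V -> W (arrow_val @^-1` V) by move=> /gW.
have gB : g B.
  have /closed_beta_open : closure (beta_open B) g; last by [].
  move=> V /Wg WV; have [a [aB aV]] := filter_ex (filterI WB WV).
  by exists (arrow_val a).
have gF : F (beta_map snd g).
  apply: cF => V /beta_map_continuous /Wg WV.
  have [a aV] := filter_ex WV; exists (beta_map snd (arrow_val a)); split => //.
  exact: (arrow_valP a).2.
have [a ag] := arrow_val_ex (filterS Br gB) gF.
exists a; split; first by rewrite /= ag.
move=> V /nbhs_arrow_val[D aD DV].
have : nbhs g (beta_open D) by apply/nbhs_betaP; exists D => //; rewrite -ag.
by move=> /Wg; apply: filterS => a'; exact: DV.
Qed.

(* Tietze's theorem on the closed set of arrows of propagation S over F. *)
Lemma compactly_supported_extension (f : GF -> R) : closed F -> continuous f ->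
  compact (closure [set a | f a != 0]) -> (forall a, 0 <= f a) ->
  exists (S : R) (h : beta (X * X) -> R),
    [/\ 0 <= S, forall g, 0 <= h g, forall g : beta (X * X), h g != 0 -> g (tube X S),
      forall a, h (arrow_val a) = f a &
      forall (g : beta (X * X)) (d : R), 0 < d -> g [set z | `|h (beta_pt z) - h g| < d]].
Proof.
move=> cF cf cK f0.
(* One S bounds both the propagation on the support, by compactness, and the values of f, as
   Tietze's theorem requires. *)
have [S [S0 fS]] : exists S : R, 0 < S /\ forall a, f a != 0 ->
    arrow_val a (tube X S) /\ `|f a| <= S.
  move/compact_near_coveringP : cK.
  move=> /(_ R +oo (fun S a => arrow_val a (tube X S) /\ `|f a| <= S) _)[].
    move=> a Ca; have [[r ar] _] := arrow_valP a.
    have fa : \forall a' \near a, `|f a'| < `|f a| + 1.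
      have /(_ _ [set y | y < `|f a| + 1]) := cvg_norm (cf a).
      by apply; apply: lt_nbhsl; rewrite ltrDl.
    exists ([set a' | arrow_val a' (tube X r) /\ `|f a'| < `|f a| + 1],
            [set S | r <= S /\ `|f a| + 1 <= S]) => /=.
      split; first by apply: filterI => //; apply/nbhs_arrow_val; exists (tube X r).
      by near=> S; split; near: S; apply: nbhs_pinfty_ge; exact: num_real.
    move=> [a' S] /= [[a'r fa'] [rS faS]]; split.
      by apply: (filterS _ a'r) => xy /= /le_trans; apply.
    by apply: ltW; exact: lt_le_trans faS.
  move=> S [_ HS].
  exists (Num.max (S + 1) 1); split; first by rewrite lt_max ltr01 orbT.
  move=> a fa.
  have [||aS faS] := HS (Num.max (S + 1) 1) _ a.
  - by rewrite lt_max ltrDl ltr01.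
  - exact: subset_closure.
  by [].
pose A : set (beta (X * X)) := beta_open (tube X S) `&` (beta_map snd @^-1` F).
have cA : closed A.
  apply: closedI; first exact: closed_beta_open.
  by apply: closed_comp => // ? _; exact: beta_map_continuous.
pose fh g : R := if pselect (exists a : GF, arrow_val a = g) is left H
  then f (projT1 (cid H)) else 0.
have fhE a : fh (arrow_val a) = f a.
  rewrite /fh; case: pselect => [H|[]]; last by exists a.
  by case: cid => b /= /arrow_val_inj ->.
have nX : normal_space (beta (X * X)).
  exact: compact_normal (@beta_hausdorff _) (@beta_compact _).
have [|g Ag|h0 [h0E ch0 _]] := @continuous_bounded_extension _ R nX A cA fh S S0.
- apply/subspace_continuousP => g Ag V.
  have [a ag] := arrow_val_ex Ag.1 Ag.2.
  move=> Vg; have : nbhs (f a) V by rewrite -fhE ag.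
  move=> /cf /nbhs_arrow_val[B aB BV].
  rewrite /= /within/=; apply/nbhs_betaP; exists B; first by rewrite -ag.
  move=> g' g'B Ag'; have [a' ag'] := arrow_val_ex Ag'.1 Ag'.2.
  have Vfa : V (f a') by apply: BV; rewrite ag'.
  have fhg : fh g' = f a' by rewrite -ag' fhE.
  by rewrite /preimage /from_subspace/= fhg.
- have [a <-] := arrow_val_ex Ag.1 Ag.2; rewrite fhE.
  have [->|/fS[]//] := eqVneq (f a) 0; by rewrite normr0 ltW.
(* [beta_open (tube X S)] is clopen, so the cut-off preserves continuity; the absolute value
   restores the positivity that the extension may lose. *)
pose h (g : beta (X * X)) : R := if pselect (g (tube X S)) is left _ then `|h0 g| else 0.
exists S, h; split.
- exact: ltW.
- by move=> g; rewrite /h; case: pselect.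
- by move=> g; rewrite /h; case: pselect => //; rewrite eqxx.
- move=> a; rewrite /h; case: pselect => [aS|naS].
    have aA : A (arrow_val a) by split => //; exact: (arrow_valP a).2.
    by rewrite -(h0E _ (mem_set aA)) fhE ger0_norm.
  by apply/esym/eqP/negPn/negP => /fS[].
- move=> g d d0; have [gS|gS] := pselect (g (tube X S)).
    have := beta_pt_cvg (ch0 g _ (nbhsx_ballx (h0 g) d d0)) => gB.
    apply: (filterS _ (filterI gS gB)) => z [zS zB] /=.
    rewrite /h; case: pselect => [_|[]]; last exact/beta_ptP.
    case: pselect => // _.
    by apply: le_lt_trans (ler_dist_dist _ _) _; rewrite distrC.
  move/beta_setC: (gS) => gnS; apply: (filterS _ gnS) => z nz /=.
  rewrite /h; case: pselect => [/beta_ptP//|_]; case: pselect => // _.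
  by rewrite subrr normr0.
Unshelve. all: by end_near. Qed.

End reduction_facts.

Section coloring.
Context {R : realType} (X : metricType R) (r : R) (N : nat) (k : X -> nat).
Hypothesis kN : forall x, (k x < N)%N.
Hypothesis kinj : forall x y, mdist x y <= r + r -> k x = k y -> x = y.

(* colored_pt i is a partial translation x |-> z with (z, x) in the tube of
   radius r; away from its domain it takes the junk value x. *)
Definition colored_ball (i : nat) (x : X) : set X :=
  [set z | mdist x z <= r /\ k z = i].

Definition colored_pt (i : nat) (x : X) : X := xget x (colored_ball i x).

Lemma colored_ptP i x : colored_ball i x !=set0 ->
  mdist x (colored_pt i x) <= r /\ k (colored_pt i x) = i.
Proof. by move=> [z xz]; exact: (@xgetI _ _ (colored_ball i x) z). Qed.

Lemma colored_pt_uniq i x z : mdist x z <= r -> k z = i ->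
  colored_ball i x !=set0 /\ z = colored_pt i x.
Proof.
move=> xz kz; have ne : colored_ball i x !=set0 by exists z.
split => //; have [xt kt] := colored_ptP ne.
apply: kinj; last by rewrite kz kt.
apply: le_trans (metric_triangle z x _) _; apply: lerD => //.
by rewrite metric_sym.
Qed.

(** The index set of the right-hand sum sits inside ['I_N] whatever x is, so that limits along an
    ultrafilter of points x can be taken term by term. *)
Lemma sum_colored (V : zmodType) (F : X -> V) (x : X) (s : seq X) : uniq s ->
  (forall z, mdist x z <= r -> z \in s) ->
  (forall z, F z != 0 -> mdist x z <= r) ->
  \sum_(z <- s) F z =
  \sum_(i < N | `[< colored_ball i x !=set0 >]) F (colored_pt i x).
Proof.
move=> us xs Fx.
rewrite (partition_big (fun z => Ordinal (kN z)) xpredT)//= [RHS]big_mkcond/=.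
apply: eq_bigr => i _; case: asboolP => [ne|e].
  have [xt kt] := colored_ptP ne.
  rewrite big_mkcond/= (bigD1_seq _ (xs _ xt) us)/= ifT; last exact/eqP/val_inj.
  rewrite big1 ?addr0// => z zt; case: eqP => // zi.
  apply/eqP/negPn/negP => /Fx xz; move/eqP: zt; apply.
  by have [_ ] := colored_pt_uniq xz (congr1 val zi).
rewrite big1_seq// => z /andP[/eqP zi _]; apply/eqP/negPn/negP => /Fx xz.
by apply: e; exists z; split => //; exact: (congr1 val zi).
Qed.

End coloring.

(** * From amenability to a kernel on X *)

Section relative_property_A.
Context {R : realType} (X : metricType R) (U : set (beta X)).
Hypothesis bgX : bounded_geometry X.
Hypothesis Uopen : open U.
Hypothesis Uinv : @invariant_units (coarse_groupoid X) U.
Hypothesis UA : partial_property_A U.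

Lemma invariant_tube (r : R) (g : beta (X * X)) : g (tube X r) ->
  U (beta_map snd g) -> U (beta_map fst g).
Proof.
move=> gr gU; have gA : g \in coarse_arrows (X := X) by apply/mem_set/coarse_arrowsP; exists r.
pose a : coarse_groupoid X := exist _ g gA.
have aU : U (gsrc a) by [].
by have := Uinv aU.
Qed.

(** Choosing for each x a point [y x] of D within r turns [p] into the range of the limit of the
    arrows (x, y x), whose source contains D and hence lies in U. *)
Lemma invariant_neighborhood (D : set X) (r : R) :
  (forall p : beta X, p D -> U p) -> forall p : beta X,
  p [set x | exists2 y, D y & mdist x y <= r] -> U p.
Proof.
move=> DU p pDr.
pose y x : X := xget x [set y | D y /\ mdist x y <= r].
pose g := beta_map (fun x => (x, y x)) p.
have yP x : (exists2 y, D y & mdist x y <= r) -> D (y x) /\ mdist x (y x) <= r.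
  by move=> [z Dz xz]; exact: (@xgetI _ _ [set y | D y /\ mdist x y <= r] z).
have -> : p = beta_map fst g by rewrite beta_map_comp; exact: (esym (beta_map_id p)).
apply: (@invariant_tube r).
  by apply: (filterS _ pDr) => x /yP[].
by apply: DU; apply: (filterS _ pDr) => x /yP[].
Qed.

(** An arbitrary list [s] containing the ball is allowed, so that later sums can use whichever
    enumeration is at hand; the extra terms vanish. *)
Lemma relative_property_A (R0 e : R) : 0 <= R0 -> 0 < e ->
  exists (D : set X) (S : R) (g : X * X -> R),
    [/\ forall p : beta X, p D -> U p, 0 <= S, forall zx, 0 <= g zx,
      forall zx, g zx != 0 -> tube X S zx &
      forall x y s, ~ D x -> mdist x y <= R0 -> uniq s ->
        (forall z, mdist x z <= S + R0 -> z \in s) ->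
        `|\sum_(z <- s) g (z, x) - 1| < e /\
        \sum_(z <- s) `|g (z, x) - g (z, y)| < e].
Proof.
move=> R00 e0; have e20 : 0 < e / 2 by rewrite divr_gt0.
have cF : closed (~` U) by exact: open_closedC.
pose GU := @reduction (coarse_groupoid X) (~` U).
(* The other half of e is kept for passing from the limit along an ultrafilter back to a point. *)
have [f [cf cK f0 fK]] := UA e20 (compact_arrow_val cF (@subset_refl _ (tube X R0))).
have [S [h [S0 h0 hS hf hcont]]] := compactly_supported_extension cF cf cK f0.
pose g zx := h (beta_pt zx).
pose good x y s := `|\sum_(z <- s) g (z, x) - 1| < e /\
        \sum_(z <- s) `|g (z, x) - g (z, y)| < e.
pose bad x (ys : X * seq X) := [/\ mdist x ys.1 <= R0, uniq ys.2,
  forall z, mdist x z <= S + R0 -> z \in ys.2 & ~ good x ys.1 ys.2].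
exists [set x | exists ys, bad x ys], S, g; split => //; last first.
- move=> x y s nD xy us xs; apply: contrapT => ngood.
  by apply: nD; exists (y, s).
- by move=> zx /hS /beta_ptP.
- by move=> zx; exact: h0.
move=> p pD; apply: contrapT => pU.
(* c below is the limit along p of the arrows (x, y x), and the a i, limits of the
   (t i x, x), are the arrows of the fibre over p that can meet the support of f. *)
pose ys x := xget (x, [::]) (bad x).
have ysP x : (exists ys, bad x ys) -> bad x (ys x).
  by move=> [z xz]; exact: (@xgetI _ _ (bad x) z).
pose y x := (ys x).1.
(* For a bad x, both g (z, x) and g (z, y x) vanish unless z is within S + R0 of x; twice that
   radius makes the color determine z. *)
have [N [k [kN kinj]]] := bounded_geometry_coloring bgX ((S + R0) + (S + R0)).
pose A i := [set x | colored_ball (S + R0) k i x !=set0].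
pose t i x := colored_pt (S + R0) k i x.
(* If the source of this limit were in U, invariance would put its range [p] into U. *)
have [c cE] : exists c : GU,
    arrow_val c = beta_map (fun x => (x, y x)) p.
  apply: (@arrow_val_ex _ _ _ _ R0).
    by apply: (filterS _ pD) => x /ysP[].
  move=> sU; apply: pU.
  have -> : p = beta_map fst (beta_map (fun x => (x, y x)) p).
    by rewrite beta_map_comp; exact: (esym (beta_map_id p)).
  by apply: (@invariant_tube R0 _ _ sU); apply: (filterS _ pD) => x /ysP[].
have cK' : arrow_val c (tube X R0).
  by rewrite cE; apply: (filterS _ pD) => x /ysP[].
have crng : grng c = p.
  by rewrite /= -/(arrow_val c) cE beta_map_comp; exact: beta_map_id.
have csrc : beta_map snd (arrow_val c) = beta_map y p by rewrite cE beta_map_comp.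
(* The colors that occur around [p]-almost every x; the ultrafilter [p] decides each color. *)
pose P := [pred i : 'I_N | `[< p (A i) >]].
have ax (i : 'I_N) : exists a : GU, P i ->
    arrow_val a = beta_map (fun x => (t i x, x)) p.
  have [/asboolP Pi|nPi] := boolP (P i); last by exists c.
  have [||a aE] := @arrow_val_ex _ _ (~` U) (beta_map (fun x => (t i x, x)) p) (S + R0).
  - by apply: (filterS _ Pi) => x /colored_ptP[]; rewrite /tube /= metric_sym.
  - by rewrite beta_map_comp; rewrite (_ : _ \o _ = id)// beta_map_id.
  by exists a.
pose a i := projT1 (cid (ax i)).
have aE i : P i -> arrow_val (a i) = beta_map (fun x => (t i x, x)) p.
  exact: projT2 (cid (ax i)).
have asrc i : P i -> gfiber (grng c) (a i).
  move=> Pi; rewrite crng.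
  have : beta_map snd (arrow_val (a i)) = p.
    by rewrite aE// beta_map_comp; exact: beta_map_id.
  by [].
have acol i : P i -> arrow_val (a i) [set zx | k zx.1 = i].
  move=> Pi; rewrite aE//; move/asboolP : Pi => Pi.
  by apply: (filterS _ Pi) => x /colored_ptP[].
have ainj i j : P i -> P j -> a i = a j -> i = j.
  move=> Pi Pj ij; apply: val_inj => /=.
  have := acol i Pi; rewrite ij => pj.
  have /filter_ex[zx [/= <- <-]//] : arrow_val (a j)
    ([set zx | k zx.1 = i] `&` [set zx | k zx.1 = j]).
  by apply: filterI => //; exact: acol.
(* The product is an [xget] over the arrows with prescribed range and source. The limit of (t i x, y
   x) is such an arrow, unique by [coarse_arrow_inj], and it lies over the complement of U, so
   [insubd] does not fall back on its default. *)
have amul i : P i -> arrow_val (gmul (a i) c) = beta_map (fun x => (t i x, y x)) p.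
  move=> Pi; have /asboolP pA := Pi.
  have [||b bE] := @arrow_val_ex _ _ (~` U) (beta_map (fun x => (t i x, y x)) p)
      (S + R0 + R0).
  - apply: (filterS _ (filterI pA pD)) => x [/colored_ptP[xt _] /ysP[xy _ _ _]].
    rewrite /tube/=; apply: le_trans (metric_triangle _ x _) _; apply: lerD => //.
    by rewrite metric_sym.
  - by rewrite beta_map_comp -[X in _ X]/(beta_map y p) -csrc; exact: (arrow_valP c).2.
  rewrite -bE; have -> : gmul (a i) c = insubd (a i) (gmul (\val (a i)) (\val c)) by [].
  set w := gmul (\val (a i)) (\val c).
  suff -> : w = \val b by rewrite valKd.
  have [w1 w2] : grng w = grng (\val (a i)) /\ gsrc w = gsrc (\val c).
    apply: (@xgetI _ (\val (a i)) [set d : coarse_groupoid X |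
      grng d = grng (\val (a i)) /\ gsrc d = gsrc (\val c)] (\val b)).
    split.
      change (beta_map fst (arrow_val b) = beta_map fst (arrow_val (a i))).
      by rewrite bE aE// !beta_map_comp.
    change (beta_map snd (arrow_val b) = beta_map snd (arrow_val c)).
    by rewrite bE csrc !beta_map_comp.
  apply: val_inj; apply: (coarse_arrow_inj bgX).
  - exact: (set_mem (valP w)).
  - exact: (set_mem (valP (\val b))).
  - apply: (etrans w1).
    change (beta_map fst (arrow_val (a i)) = beta_map fst (arrow_val b)).
    by rewrite bE aE// !beta_map_comp.
  - apply: (etrans w2).
    change (beta_map snd (arrow_val c) = beta_map snd (arrow_val b)).
    by rewrite bE csrc !beta_map_comp.
have [fK1 fK2] := fK c cK'.
(* The first fibre sum is needed exactly, so the [a i] must exhaust the support of f in the fibre;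
   for the second sum an inequality is enough. *)
have [_ E1] := esum_finite_image f0 asrc ainj.
have [E2 _] := esum_finite_image (fun b => normr_ge0 (f b - f (gmul b c))) asrc ainj.
rewrite E1 in fK1; last first.
  move=> b; rewrite crng => bp fb.
  have bS : arrow_val b (tube X S) by apply: hS; rewrite hf.
  have bp' : beta_map snd (arrow_val b) = p by [].
  have [i bi] := beta_finite_cover (beta_map fst (arrow_val b)) kN.
  have iN : (i < N)%N by have [x <-] := filter_ex bi; exact: kN.
  have bSi : arrow_val b [set zx | zx.1 = t i zx.2 /\ A i zx.2].
    apply: (filterS _ (filterI bS bi)) => -[z x] [zx kz]; rewrite /tube/= in zx.
    have [|e1 e2] := @colored_pt_uniq _ _ _ _ kinj i x z _ kz; last by [].
    by rewrite metric_sym; apply: (le_trans zx); rewrite lerDl.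
  have Pi : P (Ordinal iN).
    by apply/asboolP; rewrite -bp'; apply: (filterS _ bSi) => -[z x] [].
  exists (Ordinal iN) => //; apply: arrow_val_inj; rewrite aE//.
  apply: beta_eqP => B bB; rewrite -bp'.
  by apply: (filterS _ (filterI bB bSi)) => -[z x] [+ [/= e1 _]]; rewrite /= -e1.
have {E2}fK2 := le_lt_trans E2 fK2.
rewrite lte_fin in fK2.
rewrite -EFinB abse_EFin lte_fin in fK1.
(* At most N colors contribute, so errors d sum to at most e / 4. The invariance sum has two errors
   per color, and e / 2 + 2 (e / 4) = e. [N.+1] keeps the denominator nonzero. *)
pose d := e / (4 * N.+1%:R).
have d0 : 0 < d by rewrite divr_gt0// mulr_gt0.
(* These are finitely many conditions, each true [p]-almost everywhere, so some bad point satisfies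
   them all. The equivalence with [P i] makes the colors around that point those of the limit. *)
have pgood : p [set x | forall i : 'I_N, (A i x <-> P i) /\
    (P i -> `|g (t i x, x) - f (a i)| < d /\
            `|g (t i x, y x) - f (gmul (a i) c)| < d)].
  apply: filter_forall => i; have [Pi|nPi] := boolP (P i); last first.
    have npA : p (~` A i) by apply/beta_setC => /asboolP; exact/negP.
    by apply: (filterS _ npA) => x /= nA; split.
  have pA : p (A i) by exact/asboolP.
  have H1 : p [set x | `|g (t i x, x) - h (beta_map (fun x => (t i x, x)) p)| < d].
    exact: (hcont (beta_map (fun x => (t i x, x)) p) d d0).
  have H2 : p [set x | `|g (t i x, y x) - h (beta_map (fun x => (t i x, y x)) p)| < d].
    exact: (hcont (beta_map (fun x => (t i x, y x)) p) d d0).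
  apply: (filterS _ (filterI pA (filterI H1 H2))) => x [Ax [H1x H2x]]; split => // _.
  by rewrite -!hf amul// aE.
have [x [xD xg]] := filter_ex (filterI pD pgood).
have [xy us xs] := ysP x xD; apply.
have R0S z : mdist x z <= S -> mdist x z <= S + R0.
  by move=> /le_trans; apply; rewrite lerDl.
have gx z : g (z, x) != 0 -> mdist x z <= S.
  by move=> /hS /beta_ptP; rewrite /tube/= metric_sym.
have gy z : g (z, y x) != 0 -> mdist x z <= S + R0.
  move=> /hS /beta_ptP; rewrite /tube/= => zy.
  apply: le_trans (metric_triangle x (y x) z) _; rewrite addrC; apply: lerD => //.
  by rewrite metric_sym.
have Pcol (V : zmodType) (F : 'I_N -> V) :
    \sum_(i < N | `[< colored_ball (S + R0) k i x !=set0 >]) F i = \sum_(i | P i) F i.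
  apply: eq_bigl => i; have [xi _] := xg i.
  by apply/asboolP/idP => /xi.
have sumd : \sum_(i | P i) d <= e / 4.
  apply: (@le_trans _ _ (\sum_(i < N) d)).
    by rewrite [leLHS]big_mkcond/=; apply: ler_sum => i _; case: ifP => // _; exact: ltW.
  rewrite sumr_const card_ord -[_ *+ N]mulr_natr /d.
  rewrite invfM mulrA -mulrA ler_piMr//; first by rewrite ltW// divr_gt0.
  by rewrite mulrC ler_pdivrMr// mul1r ler_nat.
split.
  rewrite (sum_colored kN kinj us xs) ?Pcol; last by move=> z /gx/R0S.
  have -> : \sum_(i | P i) g (t i x, x) - 1 = \sum_(i | P i) (g (t i x, x) - f (a i))
     + (\sum_(i | P i) f (a i) - 1).
    by rewrite sumrB addrA subrK.
  apply: le_lt_trans (ler_normD _ _) _.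
  have : `|\sum_(i | P i) (g (t i x, x) - f (a i))| <=
    \sum_(i | P i) `|g (t i x, x) - f (a i)| by exact: ler_norm_sum.
  have : \sum_(i | P i) `|g (t i x, x) - f (a i)| <= \sum_(i | P i) d.
    by apply: ler_sum => i Pi; have [_ /(_ Pi)[/ltW]] := xg i.
  move: sumd fK1 e0; lra.
rewrite (sum_colored kN kinj us xs (F := fun z => `|g (z, x) - g (z, y x)|)); last first.
  move=> z; rewrite normr_eq0 => gxy; have [gx0|/gx/R0S//] := eqVneq (g (z, x)) 0.
  by apply: gy; move: gxy; rewrite gx0 sub0r oppr_eq0.
rewrite Pcol.
have : \sum_(i | P i) `|g (t i x, x) - g (t i x, y x)| <=
  \sum_(i | P i) (`|f (a i) - f (gmul (a i) c)| + (d + d)).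
  apply: ler_sum => i Pi; have [_ /(_ Pi)[gi1 gi2]] := xg i.
  have -> : g (t i x, x) - g (t i x, y x) = (f (a i) - f (gmul (a i) c)) +
    ((g (t i x, x) - f (a i)) - (g (t i x, y x) - f (gmul (a i) c))) by ring.
  apply: le_trans (ler_normD _ _) _; apply: lerD => //.
  apply: le_trans (ler_normB _ _) _.
  by apply: lerD; exact: ltW.
rewrite !big_split/=; move: sumd fK2 e0; lra.
Qed.

End relative_property_A.

(** * Singular value decompositions *)

Section complex_Re.
Context {R : realType}.
Implicit Types (a : R) (z w : R[i]).

Lemma Re_conj z : complex.Re (Num.conj z) = complex.Re z.
Proof. by case: z. Qed.

Lemma ReD z w : complex.Re (z + w) = complex.Re z + complex.Re w.
Proof. by case: z; case: w. Qed.

Lemma normC_Re z : `|z| = (complex.Re `|z|)%:C.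
Proof. by rewrite normc_def. Qed.

Lemma Re_norm_ge0 z : 0 <= complex.Re `|z|.
Proof. by rewrite normc_def sqrtr_ge0. Qed.

Lemma Re_norm_eq0 z : complex.Re `|z| = 0 -> z = 0.
Proof. by move=> z0; apply/eqP; rewrite -normr_eq0 normC_Re z0. Qed.

Lemma Re_norm_real a : complex.Re `|a%:C| = `|a|.
Proof. by rewrite normc_def/= expr0n/= addr0 sqrtr_sqr. Qed.

Lemma Re_normM z w : complex.Re `|z * w| = complex.Re `|z| * complex.Re `|w|.
Proof. by rewrite normrM (normC_Re z) (normC_Re w) -rmorphM. Qed.

Lemma mul_conj z : z * Num.conj z = ((complex.Re `|z|) ^+ 2)%:C.
Proof. by rewrite -normCK rmorphXn/= -normC_Re. Qed.

End complex_Re.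

Section normed_facts.
Context {R : realType} {V : normedModType R[i]}.
Implicit Types (u v w : V).

Lemma cnormN v : cnorm (- v) = cnorm v.
Proof. by rewrite /cnorm normrN. Qed.

Lemma cnormB u v : cnorm (u - v) = cnorm (v - u).
Proof. by rewrite -cnormN opprB. Qed.

Lemma ler_cnormB u v : cnorm u - cnorm v <= cnorm (u - v).
Proof. by rewrite lerBlDr; have := cnormD (u - v) v; rewrite subrK. Qed.

Lemma cnormZr (a : R) v : cnorm (a%:C *: v) = `|a| * cnorm v.
Proof. by rewrite cnormZ Re_norm_real. Qed.

Lemma cnorm_sum (I : Type) (s : seq I) (P : pred I) (f : I -> V) :
  cnorm (\sum_(i <- s | P i) f i) <= \sum_(i <- s | P i) cnorm (f i).
Proof.
elim/big_rec2: _ => [|i a b _ ab]; first by rewrite cnorm0.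
by apply: le_trans (cnormD _ _) _; rewrite lerD2l.
Qed.

Lemma opnorm_leP (W : normedModType R[i]) (T : V -> W) (c : R) :
  opnorm_le T c <-> forall v, cnorm (T v) <= c * cnorm v.
Proof.
by split=> Tc v; have := Tc v; rewrite !cnormE -rmorphM lecR.
Qed.

Lemma ball_cnorm v (e : R) w : ball v e%:C w <-> cnorm (v - w) < e.
Proof. by rewrite -ball_normE /= cnormE ltcR. Qed.

Lemma posC (e : R[i]) : 0 < e -> exists2 d : R, 0 < d & e = d%:C.
Proof.
case: e => a b; rewrite ltcE/= => /andP[/eqP -> a0]; by exists a.
Qed.

Lemma cvg_cnormP (T : Type) (F : set_system T) (FF : Filter F) (f : T -> V) v :
  f @ F --> v <-> forall e : R, 0 < e -> F [set x | cnorm (v - f x) < e].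
Proof.
rewrite cvg_ballP; split=> H e e0.
  have := H e%:C; rewrite ltcR => /(_ e0).
  by apply: filterS => x /ball_cnorm.
have [d d0 ->] := posC e0; have := H d d0.
by apply: filterS => x /ball_cnorm.
Qed.

End normed_facts.

Section hilbert_facts.
Context {R : realType} {H : hilbertType R}.
Implicit Types (u v w x y : H).

Lemma innerC u v : inner u v = Num.conj (inner v u).
Proof. by rewrite (@hermC _ _ _ _ (@inner R H)) expr0 mul1r. Qed.

Lemma inner_cnorm v : inner v v = ((cnorm v) ^+ 2)%:C.
Proof. by rewrite innerE cnormE -rmorphXn. Qed.

Lemma cnorm_sqr v : (cnorm v) ^+ 2 = complex.Re (inner v v).
Proof. by rewrite inner_cnorm. Qed.

Lemma cnormD_sqr u v : (cnorm (u + v)) ^+ 2 =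
  (cnorm u) ^+ 2 + (cnorm v) ^+ 2 + 2 * complex.Re (inner u v).
Proof.
rewrite !cnorm_sqr linearDl !linearDr/= !ReD.
by rewrite (innerC v u) Re_conj; ring.
Qed.

Lemma cnormD_ortho u v : inner u v = 0 ->
  (cnorm (u + v)) ^+ 2 = (cnorm u) ^+ 2 + (cnorm v) ^+ 2.
Proof. by move=> uv; rewrite cnormD_sqr uv/= mulr0 addr0. Qed.

Lemma parallelogram u v : (cnorm (u - v)) ^+ 2 =
  2 * (cnorm u) ^+ 2 + 2 * (cnorm v) ^+ 2 - (cnorm (u + v)) ^+ 2.
Proof.
rewrite !cnormD_sqr cnormN linearNr/=.
have -> : complex.Re (- inner u v) = - complex.Re (inner u v) by case: (inner u v).
by ring.
Qed.

Lemma cnorm_sum_ortho (I : eqType) (s : seq I) (P : pred I) (w : I -> H) : uniq s ->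
  (forall i j, P i -> P j -> i != j -> inner (w i) (w j) = 0) ->
  (cnorm (\sum_(i <- s | P i) w i)) ^+ 2 = \sum_(i <- s | P i) (cnorm (w i)) ^+ 2.
Proof.
move=> + wij; elim: s => [|i s IH /= /andP[is_ us]].
  by move=> _; rewrite !big_nil cnorm0 expr0n.
rewrite !big_cons; case: ifPn => [Pi|_]; last exact: IH.
rewrite cnormD_ortho ?IH// linear_sumr/= big1_seq// => j /andP[Pj js].
by apply: wij => //; apply: contraNneq is_ => ->.
Qed.

Lemma bessel (I : eqType) (s : seq I) (P : pred I) (v : I -> H) x : uniq s ->
  (forall i j, P i -> P j -> inner (v i) (v j) = (i == j)%:R) ->
  \sum_(i <- s | P i) (complex.Re `|inner x (v i)|) ^+ 2 <= (cnorm x) ^+ 2.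
Proof.
move=> us vij; pose p := \sum_(i <- s | P i) inner x (v i) *: v i.
have pE : (cnorm p) ^+ 2 = \sum_(i <- s | P i) (complex.Re `|inner x (v i)|) ^+ 2.
  rewrite cnorm_sum_ortho//.
    apply: eq_bigr => i Pi; rewrite cnormZ exprMn [X in _ * X]cnorm_sqr vij// eqxx.
    by rewrite mulr1.
  move=> i j Pi Pj ij; rewrite linearZl_LR linearZr_LR/= vij// (negbTE ij).
  by rewrite !mulr0.
have xp : inner (x - p) p = 0.
  rewrite linearBl/= inner_cnorm pE linear_sumr/= rmorph_sum/=.
  rewrite -sumrB big1// => i _; rewrite linearZr_LR/= mulrC mul_conj.
  exact: subrr.
by rewrite -pE -[in leRHS](subrK p x) cnormD_ortho// lerDr sqr_ge0.
Qed.

Lemma inner_unit_le x v : cnorm v = 1 -> complex.Re `|inner x v| <= cnorm x.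
Proof.
move=> v1; rewrite -ler_sqr ?nnegrE ?Re_norm_ge0 ?cnorm_ge0//.
have := @bessel unit [:: tt] xpredT (fun=> v) x isT.
rewrite big_seq1; apply => i j _ _; rewrite inner_cnorm v1 expr1n.
by case: i; case: j.
Qed.

End hilbert_facts.

(** * Compactness as total boundedness *)

Section totally_bounded.
Context {R : realType} {H : completeNormedModType R[i]}.
Implicit Types (S T : H -> H).

(* Equivalent to compact_op, but visibly stable under norm limits. *)
Definition totally_bounded_op S := forall e : R, 0 < e ->
  exists s : seq H, forall v, cnorm v <= 1 -> exists2 c, c \in s & cnorm (S v - c) < e.

Lemma ultra_seq_cover (T : Type) (I : eqType) (G : set_system T) (A : set T)
    (s : seq I) (P : I -> set T) : UltraFilter G -> G A ->
  (forall x, A x -> exists2 i, i \in s & P i x) -> exists2 i, i \in s & G (P i).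
Proof.
move=> GU + AP; elim: s A AP => [|i s IH] A AP GA.
  by have [x /AP[]] := filter_ex GA.
have [GP|GnP] := in_ultra_setVsetC (P i) GU; first by exists i; rewrite ?mem_head.
have [||j js GPj] := IH (A `&` ~` P i).
- move=> x [/AP[j + Pj] nPi]; rewrite inE => /orP[/eqP ji|]; last by exists j.
  by case: nPi; rewrite -ji.
- exact: filterI.
by exists j => //; rewrite inE js orbT.
Qed.

Lemma compact_op_totally_bounded S : compact_op S -> totally_bounded_op S.
Proof.
move=> [K SK [cK _]] e e0; move: cK; rewrite compact_cover => cK.
have [||D _ KD] := cK H setT (fun c => ball c e%:C).
- by move=> c _; apply: ball_open; rewrite ltcR.
- by move=> c _; exists c => //; apply: ballxx; rewrite ltcR.
exists (enum_fset D) => v v1.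
have [|c cD /ball_cnorm cv] := KD (S v).
  by apply: SK; exists v => //=; rewrite cnormE (_ : 1 = 1%:C)// lecR.
by exists c => //; rewrite cnormB.
Qed.

(** Finite nets of every radius make each ultrafilter on the closed image Cauchy, and H is
    complete. *)
Lemma totally_bounded_compact_op S : totally_bounded_op S -> compact_op S.
Proof.
move=> tS; rewrite /compact_op precompactE compact_ultra => G GU GA.
have cG : cauchy G.
  apply: cauchy_exP => e /posC[d d0 ->].
  have [s sS] := tS _ (divr_gt0 d0 (ltr0n R 2)).
  have [|c _ Gc] := @ultra_seq_cover H H G (closure (S @` [set v | `|v| <= 1])) s
     (fun c => ball c d%:C) GU GA.
    move=> x xA.
    have d20 : 0 < (d / 2)%:C by rewrite ltcR divr_gt0.
    have [_ [[v /= v1 <-] /ball_cnorm xv]] := xA _ (nbhsx_ballx x _ d20).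
    have [|c cs cv] := sS v; first by move: v1; rewrite cnormE (_ : 1 = 1%:C)// lecR.
    exists c => //; apply/ball_cnorm.
    have -> : c - x = (c - S v) + (S v - x) by rewrite addrA subrK.
    apply: le_lt_trans (cnormD _ _) _.
    by rewrite (splitr d) ltrD// cnormB.
  by exists c.
have Gl : G --> lim G by exact: cauchy_cvg.
exists (lim G); split; last exact: Gl.
apply: (@closed_closure _ _ (lim G)) => V nV.
exact: filter_ex (filterI GA (Gl _ nV)).
Qed.

End totally_bounded.

Lemma linear_bundle (R : realType) (V W : lmodType R[i]) (S : V -> W) :
  linear S -> exists f : {linear V -> W}, S = f.
Proof.
move=> lS.
pose m := GRing.isLinear.Build R[i] V W *:%R S lS.
pose f : {linear V -> W} := HB.pack S m.
by exists f.
Qed.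

Section svd_existence.
Context {R : realType} {H : hilbertType R}.
Implicit Types (S T : H -> H) (u v w x y : H).

(** For l nonzero this says that l is the operator norm of S, attained at the unit vector v. The
    guard admits S = 0, where u and v are arbitrary. *)
Definition singular_triple S (luv : R * H * H) :=
  let: (l, u, v) := luv in
  [/\ 0 <= l, forall x, cnorm (S x) <= l * cnorm x &
    l != 0 -> [/\ cnorm u = 1, cnorm v = 1 & S v = l%:C *: u]].

(* A vector where the norm of S is attained: along an ultrafilter of almost
   maximisers x, the values S x are Cauchy by total boundedness, hence
   |S (x + y)| is almost 2 |S| and the x are Cauchy by the parallelogram law. *)
Lemma top_singular_triple S : linear S -> (exists c, opnorm_le S c) ->
  totally_bounded_op S -> exists luv, singular_triple S luv.
Proof.
move=> /linear_bundle[f ->] [c /opnorm_leP fc] tS.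
have c0 : 0 <= Num.max c 0 by rewrite le_max lexx orbT.
have {c0} [c' c'0 {}fc] : exists2 c, 0 < c & forall v, cnorm (f v) <= c * cnorm v.
  exists (Num.max c 0 + 1); first by rewrite ltr_wpDl.
  move=> v; apply: le_trans (fc v) _; apply: ler_wpM2r; first exact: cnorm_ge0.
  by rewrite -[leLHS]addr0 lerD// le_max lexx.
pose E := [set cnorm (f x) | x in [set x : H | cnorm x <= 1]].
have E0 : E 0 by exists 0; rewrite /= ?linear0 cnorm0.
have supE : has_sup E.
  split; first by exists 0.
  exists c' => _ [x /= x1 <-]; apply: le_trans (fc x) _.
  by rewrite -[leRHS]mulr1 ler_wpM2l// ltW.
pose l := sup E.
have l0 : 0 <= l by exact: (sup_upper_bound supE).
have fl x : cnorm (f x) <= l * cnorm x.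
  have [x0|x0] := eqVneq (cnorm x) 0.
    by rewrite (cnorm_eq0 x0) linear0 !cnorm0 mulr0.
  have xp : 0 < cnorm x by rewrite lt_neqAle eq_sym x0 cnorm_ge0.
  rewrite -ler_pdivrMr//; apply: (sup_upper_bound supE).
  exists ((cnorm x)^-1%:C *: x) => /=; rewrite ?linearZ/= cnormZr gtr0_norm ?invr_gt0//.
    by rewrite mulVf.
  by rewrite mulrC.
have [l00|lN0] := eqVneq l 0.
  by exists (l, 0, 0); split => //; rewrite l00 eqxx.
have lp : 0 < l by rewrite lt_neqAle eq_sym lN0.
pose A (d : R) := [set x : H | cnorm x <= 1 /\ l - d < cnorm (f x)].
have AF : ProperFilter (filter_from [set d : R | 0 < d] A).
  apply: filter_from_proper; last first.
    move=> d d0; have [_ [x x1 <-] lx] := sup_adherent d0 supE.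
    by exists x.
  apply: filter_from_filter; first by exists 1 => /=.
  move=> d1 d2 d10 d20; exists (Num.min d1 d2); first by rewrite /= lt_min d10.
  move=> x [x1 dx]; split; split => //; apply: le_lt_trans dx; rewrite lerD2l lerN2.
    by rewrite ge_min lexx.
  by rewrite ge_min lexx orbT.
have [G [GU AG]] := ultraFilterLemma AF.
have GA d : 0 < d -> G (A d) by move=> d0; apply: AG; exists d.
have GI P Q : G P -> G Q -> G (P `&` Q) by exact: filterI.
have cG : cauchy G.
  apply: cauchy_exP => e /posC[d d0 ->].
  (* The estimates below give |x + y| > 2 - 4 t / l, so |x - y|^2 is at most about 16 t / l, which
     the second bound makes at most d^2 / 2. The first bound keeps 2 l - 4 t nonnegative for
     squaring. *)
  pose t := Num.min (l / 2) (d ^+ 2 * l / 32).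
  have t0 : 0 < t by rewrite lt_min !divr_gt0 ?mulr_gt0 ?exprn_gt0.
  have [s sS] := tS _ t0.
  have [x [x1 _]|z _ Gz] := @ultra_seq_cover H H G (A t) s
      (fun z => [set x | cnorm (f x - z) < t]) GU (GA _ t0); first exact: sS.
  have GAz := GI _ _ (GA _ t0) Gz.
  have [x [[x1 xt] xz]] := filter_ex GAz.
  exists x; apply: (filterS _ GAz) => y [[y1 yt] yz].
  apply/ball_cnorm; rewrite -(@ltr_pXn2r _ 2) ?nnegrE ?cnorm_ge0 ?(ltW d0)//.
  rewrite parallelogram.
  have fxy : cnorm (f x - f y) < t + t.
    have -> : f x - f y = (f x - z) + (z - f y) by rewrite addrA subrK.
    by apply: le_lt_trans (cnormD _ _) _; rewrite ltrD// cnormB.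
  have : 2 * cnorm (f x) - cnorm (f x - f y) <= cnorm (f (x + y)).
    rewrite lerBlDr linearD/=.
    have -> : 2 * cnorm (f x) = cnorm ((f x + f y) + (f x - f y)).
      have -> : f x + f y + (f x - f y) = (2 : R)%:C *: f x.
        rewrite addrACA subrr addr0 -mulr2n -scaler_nat; congr (_ *: _).
        by rewrite rmorph_nat.
      by rewrite cnormZr ger0_norm.
    exact: cnormD.
  have := fl (x + y).
  set n := cnorm (x + y) => h1 h2.
  have tl : t <= l / 2 by rewrite ge_min lexx.
  have td : t <= d ^+ 2 * l / 32 by rewrite ge_min lexx orbT.
  have h3 : 2 * l - 4 * t < l * n by lra.
  have x2 : cnorm x ^+ 2 <= 1 by rewrite expr_le1 ?cnorm_ge0.
  have y2 : cnorm y ^+ 2 <= 1 by rewrite expr_le1 ?cnorm_ge0.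
  suff : l ^+ 2 * (4 - n ^+ 2) < l ^+ 2 * d ^+ 2.
    rewrite ltr_pM2l ?exprn_gt0//; lra.
  have h4 : (2 * l - 4 * t) ^+ 2 < (l * n) ^+ 2.
    rewrite ltr_pXn2r// nnegrE; first lra.
    by rewrite mulr_ge0 ?cnorm_ge0.
  rewrite exprMn in h4.
  have h5 : (2 * l - 4 * t) ^+ 2 = 4 * l ^+ 2 - 16 * l * t + 16 * t ^+ 2 by ring.
  have h6 : 16 * l * t <= l ^+ 2 * d ^+ 2 / 2.
    have := ler_wpM2l (ltW lp) td; rewrite !expr2; lra.
  have h7 : 0 < l ^+ 2 * d ^+ 2 by rewrite mulr_gt0 ?exprn_gt0.
  have h8 := sqr_ge0 t.
  lra.
have Gv : G --> lim G by exact: cauchy_cvg.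
set v := lim G in Gv.
have Gnear (d : R) : 0 < d -> exists x, [/\ cnorm x <= 1, l - d < cnorm (f x) & cnorm (v - x) < d].
  move=> d0; have Gb := Gv _ (nbhsx_ballx v d%:C (etrans (ltcR _ _) d0)).
  have [x [[x1 xd] /ball_cnorm xv]] := filter_ex (GI _ _ (GA _ d0) Gb).
  by exists x.
have v1 : cnorm v <= 1.
  apply/ler_addgt0Pr => d /Gnear[x [x1 _ vx]].
  by have := ler_cnormB v x; lra.
have fv : l <= cnorm (f v).
  apply/ler_addgt0Pr => d d0.
  have [d' d'0 dE] : exists2 d', 0 < d' & c' * d' + d' = d.
    by exists (d / (c' + 1)); [rewrite divr_gt0// addr_gt0|field; rewrite gt_eqF// addr_gt0].
  have [x [_ xd vx]] := Gnear d' d'0.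
  have h1 : cnorm (f x) - cnorm (f v) <= c' * cnorm (v - x).
    by rewrite cnormB; apply: le_trans (fc _); rewrite linearB; exact: ler_cnormB.
  have h2 : c' * cnorm (v - x) <= c' * d' by rewrite ler_wpM2l ?ltW.
  have h3 : l < d' + cnorm (f x) by rewrite -ltrBlDl.
  rewrite -dE; move: h1 h2 h3; set a := cnorm (f x); set b := cnorm (f v).
  lra.
have v1' : cnorm v = 1.
  apply/eqP; rewrite eq_le v1/=.
  have := le_trans fv (fl v); rewrite -[leLHS]mulr1 ler_pM2l//.
exists (l, (l^-1)%:C *: f v, v); split => // _; split => //.
  rewrite cnormZr gtr0_norm ?invr_gt0//.
  suff -> : cnorm (f v) = l by rewrite mulVf.
  by apply/eqP; rewrite eq_le fv andbT; have := fl v; rewrite v1' mulr1.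
by rewrite scalerA -rmorphM/= mulfV// scale1r.
Qed.

(** Since v maximises |S v| / |v|, moving it by t x with t a small multiple of the conjugate of <S
    x, u> would increase |S v|^2 to first order but |v|^2 only to second order. *)
Lemma singular_triple_ortho S l u v x : linear S -> singular_triple S (l, u, v) ->
  l != 0 -> inner x v = 0 -> inner (S x) u = 0.
Proof.
move=> /linear_bundle[f ->] [l0 fl fv] ln0 xv; have {fv}[u1 v1 fv] := fv ln0.
have lp : 0 < l by rewrite lt_neqAle eq_sym ln0.
apply: contrapT => /eqP z0; set z := inner (f x) u in z0.
set X := cnorm x ^+ 2; have X0 : 0 <= X by exact: sqr_ge0.
set a := complex.Re `|z| ^+ 2.
have a0 : 0 < a.
  rewrite exprn_gt0// lt_neqAle Re_norm_ge0 andbT eq_sym.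
  by apply: contraNneq z0 => /Re_norm_eq0 ->.
(* With this s the second order term l^2 |t|^2 X equals l s a (1 - l s), which is below the first
   order gain 2 l s a. *)
pose s := (l * (X + 1))^-1.
have s0 : 0 < s by rewrite invr_gt0 mulr_gt0// ltr_wpDl.
have sE : l * s * (X + 1) = 1.
  by rewrite /s; field; rewrite !gt_eqF// ltr_wpDl.
pose t := s%:C * Num.conj z.
have tz : t * z = (s * a)%:C by rewrite /t -mulrA [_ * z]mulrC mul_conj -rmorphM.
have nt : complex.Re `|t| ^+ 2 = s ^+ 2 * a.
  by rewrite /t Re_normM Re_norm_real gtr0_norm// norm_conjC exprMn.
have e1 : inner (t *: x) v = 0 by rewrite linearZl_LR/= xv mulr0.
have e2 : inner (t *: f x) (l%:C *: u) = (l * (s * a))%:C.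
  rewrite linearZl_LR linearZr_LR/= -/z.
  have -> : Num.conj l%:C = l%:C by apply/eqP; rewrite eq_complex/= oppr0 !eqxx.
  by rewrite mulrCA tz -rmorphM.
have := fl (t *: x + v); rewrite -ler_sqr ?nnegrE ?cnorm_ge0 ?mulr_ge0 ?cnorm_ge0//.
rewrite linearP/= fv exprMn !cnormD_sqr e1 e2 !cnormZ !exprMn nt u1 v1.
rewrite Re_norm_real ger0_norm// expr1n !mulr1 mulr0 addr0 -/X.
have : 0 <= s ^+ 2 * a * cnorm (f x) ^+ 2.
  by rewrite mulr_ge0 ?sqr_ge0// mulr_ge0 ?sqr_ge0// ltW.
have h0 : 0 < l * (s * a) by rewrite mulr_gt0// mulr_gt0.
have h1 : l ^+ 2 * (s ^+ 2 * a * X + 1) = l * (s * a) * (1 - l * s) + l ^+ 2.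
  have lsX : l * s * X = 1 - l * s by rewrite -sE; ring.
  by rewrite -lsX; ring.
rewrite h1 /=.
have h2 : 0 < l * (s * a) * (l * s) by rewrite mulr_gt0// mulr_gt0.
rewrite mulrBr mulr1; lra.
Qed.

(** q projects onto the orthogonal complement of v. Writing the remainder as S after q lets it
    inherit boundedness and total boundedness, with no increase in norm. *)
Lemma deflation S l u v : linear S -> singular_triple S (l, u, v) ->
  exists q : H -> H, [/\ linear q, forall x, cnorm (q x) <= cnorm x,
    forall x, S x - l%:C *: rank_one u v x = S (q x) &
    l != 0 -> forall x, inner (q x) v = 0].
Proof.
move=> /linear_bundle[f ->] [l0 fl fv].
have [->|ln0] := eqVneq l 0.
  by exists id; split => // x; rewrite scale0r subr0.
have {fv}[u1 v1 fv] := fv ln0.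
have ortho x : inner (x - inner x v *: v) v = 0.
  by rewrite linearBl/= linearZl_LR/= inner_cnorm v1 expr1n mulr1 subrr.
exists (fun x => x - inner x v *: v); split => //.
- move=> a x y; rewrite linearPl/= scalerBr scalerDl -scalerA.
  by rewrite opprD !addrA; congr (_ + _); rewrite -!addrA; congr (_ + _); rewrite addrC.
- move=> x; rewrite -ler_sqr ?nnegrE ?cnorm_ge0//.
  have ortho2 : inner (x - inner x v *: v) (inner x v *: v) = 0.
    by rewrite linearZr_LR/= ortho mulr0.
  by have := cnormD_ortho ortho2; rewrite subrK => ->; rewrite lerDl sqr_ge0.
- move=> x; have -> : f (x - inner x v *: v) = f x - inner x v *: f v.
    by rewrite linearB linearZ.
  by rewrite fv /rank_one !scalerA mulrC.
Qed.

(* The singular triples are found one at a time, subtracting each in turn. *)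
Lemma svd_exists S : linear S -> (exists c, opnorm_le S c) ->
  totally_bounded_op S -> exists (l : nat -> R) (u v : nat -> H), is_svd S l u v.
Proof.
move=> linS bS tS.
pose sel T := xget (0, 0, 0) [set t | singular_triple T t].
pose step T x := T x - (sel T).1.1%:C *: rank_one (sel T).1.2 (sel T).2 x.
pose Sn n := iter n step S.
pose l n := (sel (Sn n)).1.1; pose u n := (sel (Sn n)).1.2; pose v n := (sel (Sn n)).2.
pose good T := [/\ linear T, exists c, opnorm_le T c & totally_bounded_op T].
have selP T : good T -> singular_triple T ((sel T).1.1, (sel T).1.2, (sel T).2).
  move=> [lT bT tT]; have [t Tt] := top_singular_triple lT bT tT.
  have := @xgetI _ (0, 0, 0) [set t | singular_triple T t] t Tt.
  by rewrite -/(sel T); case: (sel T) => -[].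
have step_good T : good T -> good (step T).
  move=> gT; have [lT [c /opnorm_leP bT] tT] := gT.
  have [q [lq qle qE _]] := deflation lT (selP _ gT).
  have -> : step T = T \o q by apply/funext => x; rewrite /step qE.
  split.
  - by move=> a x y; rewrite /= lq lT.
  - exists `|c|; apply/opnorm_leP => x /=; apply: le_trans (bT _) _.
    apply: (@le_trans _ _ (`|c| * cnorm (q x))); last by rewrite ler_wpM2l.
    by rewrite ler_wpM2r ?cnorm_ge0// ler_norm.
  - move=> e /tT[s sT]; exists s => x x1; apply: sT.
    exact: le_trans (qle _) _.
have gn n : good (Sn n).
  by elim: n => [|n IH]; [split|exact: step_good].
have tr n : singular_triple (Sn n) (l n, u n, v n) by exact: selP.
have SnS n x : Sn n.+1 x = Sn n x - (l n)%:C *: rank_one (u n) (v n) x by [].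
have SnE n x : Sn n x = S x - \sum_(i < n) (l i)%:C *: rank_one (u i) (v i) x.
  elim: n => [|n IH]; first by rewrite big_ord0 subr0.
  by rewrite SnS IH big_ord_recr/= opprD addrA.
have l0 n : 0 <= l n by have [] := tr n.
have Sl n x : cnorm (Sn n x) <= l n * cnorm x by have [] := tr n.
have uv n : l n != 0 -> [/\ cnorm (u n) = 1, cnorm (v n) = 1 &
  Sn n (v n) = (l n)%:C *: u n] by have [] := tr n.
have qn n : exists q : H -> H, [/\ linear q, forall x, cnorm (q x) <= cnorm x,
    forall x, Sn n.+1 x = Sn n (q x) & l n != 0 -> forall x, inner (q x) (v n) = 0].
  by have [lS _ _] := gn n; exact: (deflation lS (tr n)).
(* Removing from [v n] its component along [v i] leaves its image under [Sn n] unchanged, so what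
   remains still has norm at least 1; by Pythagoras the component is zero. *)
have vorth n i : l i != 0 -> l n != 0 -> Sn n (v i) = 0 -> inner (v n) (v i) = 0.
  move=> li0 ln0 Svi.
  have [ui1 vi1 _] := uv i li0; have [un1 vn1 Svn] := uv n ln0.
  set a := inner (v n) (v i).
  have [lS _ _] := gn n; have [f fE] := linear_bundle lS.
  have ortho : inner (v n - a *: v i) (a *: v i) = 0.
    rewrite linearZr_LR/= linearBl/= linearZl_LR/= inner_cnorm vi1 expr1n mulr1.
    by rewrite subrr mulr0.
  have := cnormD_ortho ortho; rewrite subrK vn1 cnormZ vi1 mulr1 expr1n => n1.
  have : 1 <= cnorm (v n - a *: v i).
    have := Sl n (v n - a *: v i); rewrite fE linearB linearZ/= -fE Svi scaler0 subr0.
    rewrite Svn cnormZr un1 mulr1 ger0_norm// ler_pMr//.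
    by rewrite lt_neqAle eq_sym ln0/=.
  move=> n2; apply: Re_norm_eq0; apply/eqP; rewrite -sqrf_eq0 eq_le sqr_ge0 andbT.
  have : 1 <= cnorm (v n - a *: v i) ^+ 2 by rewrite expr_ge1 ?cnorm_ge0.
  lra.
have inv n i : (i < n)%N -> l i != 0 ->
    Sn n (v i) = 0 /\ (forall x, inner (Sn n x) (u i) = 0).
  elim: n => // n IH; rewrite ltnS leq_eqVlt => /orP[/eqP ein|iltn] li0.
    rewrite {}ein in li0 *; have [u1 v1 Sv] := uv n li0; split.
      by rewrite SnS Sv /rank_one inner_cnorm v1 expr1n scale1r subrr.
    move=> x; have [q [_ _ qE q0]] := qn n; rewrite qE.
    by have [lS _ _] := gn n; apply: (singular_triple_ortho lS (tr n)) => //; exact: q0.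
  have [Svi Sui] := IH iltn li0; split; last first.
    by move=> x; have [q [_ _ -> _]] := qn n.
  rewrite SnS Svi sub0r.
  have [->|ln0] := eqVneq (l n) 0; first by rewrite scale0r oppr0.
  suff -> : rank_one (u n) (v n) (v i) = 0 by rewrite scaler0 oppr0.
  by rewrite /rank_one innerC (vorth _ _ li0 ln0 Svi) conjC0 scale0r.
have ortho_lt i j : (i < j)%N -> l i != 0 -> l j != 0 ->
    inner (u j) (u i) = 0 /\ inner (v j) (v i) = 0.
  move=> ij li lj; have [Svi Sui] := inv _ _ ij li; split; last exact: vorth.
  have [_ _ Svj] := uv j lj; have := Sui (v j); rewrite Svj linearZl_LR/=.
  move=> /eqP; rewrite mulf_eq0 => /orP[|/eqP//].
  by move=> /eqP -[] /eqP; rewrite (negbTE lj).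
have orthonormal (w : nat -> H) :
    (forall i, l i != 0 -> cnorm (w i) = 1) ->
    (forall i j, (i < j)%N -> l i != 0 -> l j != 0 -> inner (w j) (w i) = 0) ->
    forall i j, l i != 0 -> l j != 0 -> inner (w i) (w j) = (i == j)%:R.
  move=> w1 wlt i j li lj; have [ij|ji|->] := ltngtP i j.
  - by rewrite innerC wlt// conjC0.
  - by rewrite wlt.
  - by rewrite inner_cnorm w1// expr1n.
have lS n : l n.+1 <= l n.
  have [->//|ln1] := eqVneq (l n.+1) 0.
  have [u1 v1 Sv] := uv _ ln1; have [q [_ qle qE _]] := qn n.
  have := congr1 cnorm Sv; rewrite cnormZr u1 mulr1 ger0_norm// => <-.
  rewrite qE; apply: le_trans (Sl _ _) _; rewrite -[leRHS]mulr1 ler_wpM2l//.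
  by apply: le_trans (qle _) _; rewrite v1.
have lle m n : (m <= n)%N -> l n <= l m.
  elim: n => [|n IH]; first by rewrite leqn0 => /eqP ->.
  rewrite leq_eqVlt => /orP[/eqP ->//|]; rewrite ltnS => /IH; exact: le_trans.
(* Otherwise the S (v n) = l n u n would be infinitely many orthogonal vectors of norm at least e,
   no two within e / 2 of the same point of a finite net. *)
have lcvg (e : R) : 0 < e -> exists n, l n < e.
  move=> e0; apply: contrapT => /forallNP nl.
  have el n : e <= l n by rewrite leNgt; apply/negP.
  have ln0 n : l n != 0 by rewrite gt_eqF// (lt_le_trans e0).
  have [s sS] := tS _ (divr_gt0 e0 (ltr0n R 2)).
  have Sv n : S (v n) = (l n)%:C *: u n.
    have [u1 v1 <-] := uv n (ln0 n); rewrite SnE big1 ?subr0// => i _.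
    have [_ vv] := ortho_lt _ _ (ltn_ord i) (ln0 i) (ln0 n).
    by rewrite /rank_one vv scale0r scaler0.
  have ex n : exists2 c, c \in s & cnorm (S (v n) - c) < e / 2.
    by apply: sS; have [_ -> _] := uv n (ln0 n).
  pose c n := projT1 (cid2 (ex n)).
  have cP n : c n \in s /\ cnorm (S (v n) - c n) < e / 2.
    by rewrite /c; case: cid2.
  have cinj m n : (m < n)%N -> c m <> c n.
    move=> mn cmn; have [_ h1] := cP m; have [_ h2] := cP n; rewrite cmn cnormB in h1.
    have h3 : cnorm (S (v n) - S (v m)) < e.
      have -> : S (v n) - S (v m) = (S (v n) - c n) + (c n - S (v m)) by rewrite addrA subrK.
      by apply: le_lt_trans (cnormD _ _) _; rewrite (splitr e) ltrD.
    have [uu _] := ortho_lt _ _ mn (ln0 m) (ln0 n).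
    have : (cnorm (S (v n) - S (v m))) ^+ 2 = l n ^+ 2 + l m ^+ 2.
      rewrite !Sv cnormD_ortho; last first.
        by rewrite linearNr linearZl_LR linearZr_LR/= uu !mulr0 oppr0.
      have [un1 _ _] := uv n (ln0 n); have [um1 _ _] := uv m (ln0 m).
      by rewrite cnormN !cnormZr un1 um1 !mulr1 !ger0_norm.
    have : cnorm (S (v n) - S (v m)) ^+ 2 < e ^+ 2.
      by rewrite ltr_pXn2r ?nnegrE ?cnorm_ge0// ltW.
    have : e ^+ 2 <= l n ^+ 2 by rewrite ler_pXn2r ?nnegrE// ltW.
    have := sqr_ge0 (l m); lra.
  have : (size (map c (iota 0 (size s).+1)) <= size s)%N.
    apply: uniq_leq_size; last by move=> _ /mapP[n _ ->]; exact: (cP n).1.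
    rewrite map_inj_in_uniq ?iota_uniq// => m n _ _ cmn.
    by have [/cinj//|/cinj/nesym//|//] := ltngtP m n.
  by rewrite size_map size_iota ltnn.
exists l, u, v; split.
- split => //; apply/cvgrPdist_lt => e e0; have [n ne] := lcvg e e0.
  exists n => // m /= nm; rewrite sub0r normrN ger0_norm//.
  exact: le_lt_trans (lle _ _ nm) ne.
- by apply: orthonormal => [i /uv[]//|i j ij li lj]; exact: (ortho_lt i j ij li lj).1.
- by apply: orthonormal => [i /uv[]//|i j ij li lj]; exact: (ortho_lt i j ij li lj).2.
(* The error of the m-th partial sum is [Sn m], of norm at most [l m]. *)
- move=> x; apply/cvg_cnormP => e e0.
  have x1 : 0 < cnorm x + 1 by rewrite ltr_wpDl ?cnorm_ge0.
  have [n ne] := lcvg (e / (cnorm x + 1)) (divr_gt0 e0 x1).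
  exists n => // m /= nm; rewrite -SnE; apply: le_lt_trans (Sl _ _) _.
  have {}ne := le_lt_trans (lle _ _ nm) ne.
  rewrite ltr_pdivlMr// in ne; apply: le_lt_trans ne.
  by rewrite ler_wpM2l// lerDl.
Qed.

End svd_existence.

Section rank_facts.
Context {R : realType} {V W : lmodType R[i]}.

Lemma has_rank0 (S : V -> W) : linear S -> has_rank S 0 <-> forall x, S x = 0.
Proof.
move=> /linear_bundle[f ->]; split=> [[b [_ fb]] x|f0].
  have : lin_span b (f x) by rewrite -fb; exists x.
  by move=> [c _ <-]; rewrite big_ord0.
exists (fun=> 0); split => [c _ [//]|].
apply/seteqP; split=> [_ [x _ <-]|_ [c _ <-]].
  by exists (fun=> 0) => //; rewrite big_ord0 f0.
by rewrite big_ord0; exists 0 => //; rewrite f0.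
Qed.

(** Finite rank matters: [rank] takes the default value 0 when no rank exists. *)
Lemma rank_eq0 (S : V -> W) : linear S -> finite_rank S ->
  rank S = 0%N <-> forall x, S x = 0.
Proof.
move=> lS [n Sn]; have Sr : has_rank S (rank S) by exact: xgetI Sn.
split=> [r0|S0]; first by apply/(has_rank0 lS); rewrite -r0.
have [b [bi Sb]] := Sr; case: (rank S) b bi Sb => // m b bi Sb.
have b0 : b ord0 = 0.
  have : range S (b ord0).
    rewrite Sb; exists (fun i => (i == ord0)%:R) => //.
    rewrite (bigD1 ord0)//= scale1r big1 ?addr0// => i /negbTE ->.
    by rewrite scale0r.
  by move=> [x _ <-]; rewrite S0.
have := bi (fun i => (i == ord0)%:R).
rewrite (bigD1 ord0)//= b0 scaler0 big1 ?addr0 => [|i /negbTE ->]; last by rewrite scale0r.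
by move=> /(_ erefl ord0) /eqP; rewrite eqxx oner_eq0.
Qed.

End rank_facts.

Section truncation.
Context {R : realType} {H : hilbertType R}.
Implicit Types (S : H -> H) (x y : H).

Lemma totally_bounded_op_comp (S P : H -> H) (c : R) : totally_bounded_op S ->
  0 <= c -> (forall x y, cnorm (P x - P y) <= c * cnorm (x - y)) ->
  totally_bounded_op (P \o S).
Proof.
move=> tS c0 Pc e e0; have c1 : 0 < c + 1 by rewrite ltr_wpDl.
have [s sS] := tS _ (divr_gt0 e0 c1); exists (map P s) => v /sS[y ys vy].
exists (P y); first exact: map_f.
apply: le_lt_trans (Pc _ _) _; rewrite ltr_pdivlMr// in vy.
by apply: le_lt_trans vy; rewrite mulrC ler_wpM2l ?cnorm_ge0// lerDl.
Qed.

Section svd.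
Variables (S : H -> H) (l : nat -> R) (u v : nat -> H).
Hypothesis svdS : is_svd S l u v.

Let l0 i : 0 <= l i. Proof. by case: svdS => -[]. Qed.
Let uu i j : l i != 0 -> l j != 0 -> inner (u i) (u j) = (i == j)%:R.
Proof. by case: svdS => _ + _ _; exact. Qed.
Let vv i j : l i != 0 -> l j != 0 -> inner (v i) (v j) = (i == j)%:R.
Proof. by case: svdS => _ _ + _; exact. Qed.
Let w i x := (l i)%:C *: rank_one (u i) (v i) x.

Let u1 i : l i != 0 -> cnorm (u i) = 1.
Proof.
move=> li; have := cnorm_ge0 (u i).
have : cnorm (u i) ^+ 2 = 1 by rewrite cnorm_sqr uu// eqxx.
by move=> /eqP; rewrite sqrf_eq1 => /orP[/eqP//|/eqP ->]; rewrite ler0N1.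
Qed.

Let v1 i : l i != 0 -> cnorm (v i) = 1.
Proof.
move=> li; have := cnorm_ge0 (v i).
have : cnorm (v i) ^+ 2 = 1 by rewrite cnorm_sqr vv// eqxx.
by move=> /eqP; rewrite sqrf_eq1 => /orP[/eqP//|/eqP ->]; rewrite ler0N1.
Qed.

Let inner_w x j i : l i != 0 ->
  inner (w j x) (u i) = (l j)%:C * inner x (v j) * (j == i)%:R.
Proof.
move=> li; rewrite /w; have [->|lj] := eqVneq (l j) 0.
  by rewrite scale0r linear0l mul0r mul0r.
by rewrite !linearZl_LR/= uu// mulrA.
Qed.

Lemma svd_approx x (e : R) (M : nat) : 0 < e -> exists2 n, (M <= n)%N &
  cnorm (S x - \sum_(0 <= i < n) w i x) < e.
Proof.
move=> e0; have [_ _ _ /(_ x)/cvg_cnormP/(_ e e0)[N _ NS]] := svdS.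
exists (maxn M N); first exact: leq_maxl.
by have := NS (maxn M N) (leq_maxr _ _); rewrite big_mkord.
Qed.

Lemma svd_inner x i : l i != 0 -> inner (S x) (u i) = (l i)%:C * inner x (v i).
Proof.
move=> li; apply/eqP; rewrite -subr_eq0; apply/eqP/Re_norm_eq0/eqP.
rewrite eq_le Re_norm_ge0 andbT; apply/ler_addgt0Pr => e e0; rewrite add0r.
have [n ni ne] := svd_approx x i.+1 e0.
suff -> : inner (S x) (u i) - (l i)%:C * inner x (v i) =
    inner (S x - \sum_(0 <= j < n) w j x) (u i).
  by apply: le_trans (inner_unit_le _ (u1 li)) _; exact: ltW.
rewrite linearBl/=; congr (_ - _).
rewrite linear_sumlz/= (bigD1_seq i) ?mem_index_iota ?iota_uniq//=.
rewrite inner_w// eqxx mulr1 big1 ?addr0// => j ji.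
by rewrite inner_w// (negbTE ji) mulr0.
Qed.

Lemma svd_eval i : l i != 0 -> S (v i) = (l i)%:C *: u i.
Proof.
move=> li; apply/eqP; rewrite -subr_eq0; apply/eqP/cnorm_eq0/eqP.
rewrite eq_le cnorm_ge0 andbT; apply/ler_addgt0Pr => e e0; rewrite add0r.
have [n ni ne] := svd_approx (v i) i.+1 e0.
suff -> : (l i)%:C *: u i = \sum_(0 <= j < n) w j (v i) by exact: ltW.
rewrite (bigD1_seq i) ?mem_index_iota ?iota_uniq//= /w /rank_one vv// eqxx scale1r.
rewrite big1 ?addr0// => j ji; have [->|lj] := eqVneq (l j) 0; first by rewrite scale0r.
by rewrite vv// eq_sym (negbTE ji) scale0r scaler0.
Qed.

Lemma svd_threshold (e : R) : 0 < e -> exists M, forall i, e <= l i -> (i < M)%N.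
Proof.
move=> e0; have [[_ /cvgrPdist_lt/(_ e e0)[M _ MS]] _ _ _] := svdS.
exists M => i; apply: contraTT; rewrite -leqNgt -ltNge => /MS/=.
by rewrite sub0r normrN ger0_norm.
Qed.

Variable e : R.
Hypothesis e0 : 0 < e.
Let T x := \sum_(i \in [set i | e <= l i]) (l i)%:C *: rank_one (u i) (v i) x.

Let el i : e <= l i -> l i != 0.
Proof. by move=> ei; rewrite gt_eqF// (lt_le_trans e0). Qed.

Lemma svd_truncE (M : nat) x : (forall i, e <= l i -> (i < M)%N) ->
  T x = \sum_(0 <= i < M | e <= l i) w i x.
Proof.
move=> eM; rewrite /T -(@bigfs _ _ _ _ (index_iota 0 M) (fun i => e <= l i)) ?iota_uniq//.
by move=> i /eM iM; rewrite mem_index_iota iM.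
Qed.

Lemma svd_trunc_linear : linear T.
Proof.
have [M eM] := svd_threshold e0.
move=> a x y; rewrite !(svd_truncE _ eM) scaler_sumr -big_split/=.
apply: eq_bigr => i _; rewrite /w /rank_one linearPl/= scalerDl scalerDr !scalerA.
by congr (_ *: _ + _); rewrite mulrCA mulrA.
Qed.

(** The discarded terms have l i < e and are orthogonal because the u i are; Bessel's inequality for
    the v i bounds the sum of their squares. *)
Lemma svd_trunc_norm x : cnorm (S x - T x) <= e * cnorm x.
Proof.
have [M eM] := svd_threshold e0.
apply/ler_addgt0Pr => d d0; have [n Mn nd] := svd_approx x M d0.
have en i : e <= l i -> (i < n)%N by move=> /eM/leq_trans; apply.
have -> : S x - T x = (S x - \sum_(0 <= i < n) w i x) + (\sum_(0 <= i < n) w i x - T x).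
  by rewrite addrA subrK.
apply: le_trans (cnormD _ _) _; rewrite addrC; apply: lerD; last exact: ltW.
rewrite (svd_truncE _ en) (bigID (fun i => e <= l i))/= [X in X - _]addrC addrK.
rewrite -ler_sqr ?nnegrE ?cnorm_ge0 ?mulr_ge0 ?cnorm_ge0 ?(ltW e0)//.
rewrite cnorm_sum_ortho ?iota_uniq//; last first.
  move=> i j _ _ ij; rewrite /w.
  have [->|li] := eqVneq (l i) 0; first by rewrite scale0r linear0l.
  have [->|lj] := eqVneq (l j) 0; first by rewrite scale0r linear0r.
  by rewrite !linearZl_LR !linearZr_LR/= uu// (negbTE ij) !(scaler0, mulr0).
pose P i := l i != 0.
apply: (@le_trans _ _ (\sum_(0 <= i < n | P i) e ^+ 2 * (complex.Re `|inner x (v i)|) ^+ 2)).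
  rewrite [leLHS]big_mkcond [leRHS]big_mkcond/=; apply: ler_sum => i _; rewrite /P.
  have [li|li] := eqVneq (l i) 0.
    by case: ifP => //; rewrite /w li scale0r cnorm0 expr0n.
  case: ifPn => [|_]; last by rewrite mulr_ge0 ?sqr_ge0.
  rewrite -ltNge => ei; rewrite /w /rank_one !cnormZ u1// mulr1 exprMn Re_norm_real.
  by rewrite ler_wpM2r ?sqr_ge0// ler_sqr ?nnegrE ?(ltW e0)// ger0_norm// ltW.
rewrite -mulr_sumr exprMn ler_wpM2l ?sqr_ge0//.
by apply: bessel; rewrite ?iota_uniq.
Qed.

(** The factor [a] anticipates entries that are truncations scaled by a kernel. It is nonzero when
    the u i form a basis of the range, hence the separate case of rank 0. *)
Lemma svd_trunc_finite_rank (a : R[i]) : finite_rank (fun x => a *: T x).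
Proof.
have [->|a0] := eqVneq a 0.
  exists 0%N; apply/has_rank0 => [b x y|x]; last by rewrite scale0r.
  by rewrite !scale0r scaler0 addr0.
have [M eM] := svd_threshold e0.
pose s := [seq i <- index_iota 0 M | e <= l i].
have us : uniq s by rewrite filter_uniq// iota_uniq.
pose k (j : 'I_(size s)) := nth 0%N s j.
have kl j : l (k j) != 0.
  by have := mem_nth 0%N (ltn_ord j); rewrite mem_filter => /andP[/el].
have kinj i j : (k i == k j) = (i == j) by rewrite /k nth_uniq.
have TE x : a *: T x = \sum_j (a * ((l (k j))%:C * inner x (v (k j)))) *: u (k j).
  rewrite (svd_truncE _ eM) -big_filter -/s (big_nth 0%N) big_mkord scaler_sumr.
  by apply: eq_bigr => j _; rewrite /w /rank_one !scalerA !mulrA.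
have vc (c : 'I_(size s) -> R[i]) j : inner (\sum_i c i *: v (k i)) (v (k j)) = c j.
  rewrite linear_sumlz/= (bigD1 j)//= linearZl_LR/= vv// eqxx mulr1.
  by rewrite big1 ?addr0// => i ij; rewrite linearZl_LR/= vv// kinj (negbTE ij) mulr0.
exists (size s), (fun j => u (k j)); split.
  move=> c cu j; have := congr1 (fun z => inner z (u (k j))) cu.
  rewrite linear0l linear_sumlz/= (bigD1 j)//= linearZl_LR/= uu// eqxx mulr1.
  by rewrite big1 ?addr0// => i ij; rewrite linearZl_LR/= uu// kinj (negbTE ij) mulr0.
apply/seteqP; split=> [_ [x _ <-]|_ [c _ <-]].
  by exists (fun j => a * ((l (k j))%:C * inner x (v (k j)))) => //; rewrite TE.
exists (\sum_j (c j / (a * (l (k j))%:C)) *: v (k j)) => //.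
rewrite TE; apply: eq_bigr => j _; rewrite vc; congr (_ *: _).
rewrite mulrA mulrC divfK// mulf_neq0//; apply/eqP => -[/eqP].
by rewrite (negbTE (kl j)).
Qed.

(** By [svd_inner] the truncation is S followed by the projection onto finitely many u i, a
    Lipschitz map. *)
Lemma svd_trunc_totally_bounded (a : R[i]) : totally_bounded_op S ->
  totally_bounded_op (fun x => a *: T x).
Proof.
move=> tS; have [M eM] := svd_threshold e0.
pose P y := a *: \sum_(0 <= i < M | e <= l i) inner y (u i) *: u i.
have -> : (fun x => a *: T x) = P \o S.
  apply/funext => x; rewrite /P /= (svd_truncE _ eM); congr (_ *: _).
  by apply: eq_bigr => i /el li; rewrite svd_inner// /w /rank_one scalerA.
apply: (totally_bounded_op_comp (c := complex.Re `|a| * M%:R)) => //.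
  by rewrite mulr_ge0// Re_norm_ge0.
move=> x y; rewrite /P -scalerBr cnormZ -mulrA ler_wpM2l ?Re_norm_ge0//.
rewrite -sumrB; apply: le_trans (cnorm_sum _ _ _) _.
rewrite big_mkcond/=; apply: (@le_trans _ _ (\sum_(0 <= i < M) cnorm (x - y))).
  apply: ler_sum => i _; case: ifP => [/el li|_]; last exact: cnorm_ge0.
  rewrite -scalerBl -linearBl/= cnormZ u1// mulr1.
  exact: inner_unit_le (u1 li).
by rewrite sumr_const_nat subn0 mulr_natl.
Qed.

Lemma svd_trunc_neq0 x : T x != 0 -> exists2 y, cnorm y = 1 & e <= cnorm (S y).
Proof.
have [M eM] := svd_threshold e0.
rewrite (svd_truncE _ eM) => Tx.
have [i ei] : exists i, e <= l i.
  apply: contrapT => /forallNP nl; move/eqP : Tx; apply.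
  by rewrite big1// => i ei; case: (nl i).
by exists (v i); rewrite ?v1 ?el// svd_eval ?el// cnormZr u1 ?el// mulr1 ger0_norm.
Qed.

End svd.

(* Without svd_exists, truncation could take its default value S. *)
Lemma truncation_spec (S : H -> H) (e : R) : linear S -> (exists c, opnorm_le S c) ->
  totally_bounded_op S -> 0 < e ->
  [/\ linear (truncation e S),
    forall x, cnorm (S x - truncation e S x) <= e * cnorm x,
    forall a : R[i], finite_rank (fun x => a *: truncation e S x),
    forall a : R[i], totally_bounded_op (fun x => a *: truncation e S x) &
    forall x, truncation e S x != 0 -> exists2 y, cnorm y = 1 & e <= cnorm (S y)].
Proof.
move=> lS bS tS e0; have [l [u [v svdS]]] := svd_exists lS bS tS.
rewrite /truncation; case: xgetP => [_ -> [l' [u' [v' [svd' ->]]]]|none]; last first.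
  by case: (none (fun x => \sum_(i \in [set i | e <= l i])
      (l i)%:C *: rank_one (u i) (v i) x)); exists l, u, v.
split.
- exact: svd_trunc_linear svd' _ e0.
- exact: svd_trunc_norm svd' _ e0.
- exact: svd_trunc_finite_rank svd' _ e0.
- by move=> a; exact: svd_trunc_totally_bounded svd' _ e0 _ tS.
- exact: svd_trunc_neq0 svd' _ e0.
Qed.

End truncation.

(** * Operators on l^2(X; H) and Schur multipliers *)

Section finite_sums.

Lemma eq_big_support (V : nmodType) (I : eqType) (s t : seq I) (F : I -> V) :
  uniq s -> uniq t -> (forall i, F i != 0 -> i \in s) ->
  (forall i, F i != 0 -> i \in t) -> \sum_(i <- s) F i = \sum_(i <- t) F i.
Proof.
move=> us ut Fs Ft.
have split_supp (r : seq I) : \sum_(i <- r) F i = \sum_(i <- [seq i <- r | F i != 0]) F i.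
  rewrite big_filter [LHS](bigID (fun i => F i != 0))/=.
  rewrite [X in _ + X]big1 ?addr0// => i /negPn/eqP //.
rewrite [LHS]split_supp [RHS]split_supp; apply: perm_big.
apply: uniq_perm; rewrite ?filter_uniq// => i; rewrite !mem_filter.
by case: eqVneq => //= Fi; rewrite Fs ?Ft.
Qed.

Context {R : realType}.

Lemma ler_sum_sub (I : eqType) (s t : seq I) (F : I -> R) : uniq s -> uniq t ->
  (forall i, 0 <= F i) -> {subset s <= t} ->
  \sum_(i <- s) F i <= \sum_(i <- t) F i.
Proof.
move=> us ut F0 st; rewrite [leRHS](bigID (mem s))/=.
have -> : \sum_(i <- s) F i = \sum_(i <- t | i \in s) F i.
  rewrite -[RHS]big_filter; apply: perm_big; apply: uniq_perm; rewrite ?filter_uniq//.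
  by move=> i; rewrite mem_filter; apply/idP/andP => [is_|[]//]; split => //; exact: st.
by rewrite lerDl sumr_ge0.
Qed.

(** In this form it needs no square roots, and covers both the weights of the Schur test and the
    usual inequality. *)
Lemma weighted_cauchy_schwarz (I : Type) (s : seq I) (a b c : I -> R) :
  (forall i, a i ^+ 2 <= b i * c i) -> (forall i, 0 <= b i) -> (forall i, 0 <= c i) ->
  (\sum_(i <- s) a i) ^+ 2 <= (\sum_(i <- s) b i) * (\sum_(i <- s) c i).
Proof.
move=> abc b0 c0; elim: s => [|i s IH]; first by rewrite !big_nil expr0n mul0r.
rewrite !big_cons; set A := \sum_(j <- s) _ in IH *; set B := \sum_(j <- s) _ in IH *.
set C := \sum_(j <- s) _ in IH *.
have B0 : 0 <= B by exact: sumr_ge0.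
have C0 : 0 <= C by exact: sumr_ge0.
have h1 := abc i.
have : 2 * (a i * A) <= b i * C + B * c i.
  have h2 : (a i * A) ^+ 2 <= (b i * c i) * (B * C).
    by rewrite exprMn ler_pM ?sqr_ge0.
  have h3 : 0 <= (b i * C - B * c i) ^+ 2 by exact: sqr_ge0.
  have h4 : (2 * (a i * A)) ^+ 2 <= (b i * C + B * c i) ^+ 2 by nra.
  have h5 : 0 <= b i * C + B * c i by rewrite addr_ge0// mulr_ge0.
  apply: le_trans (ler_norm _) _; rewrite -(ger0_norm h5) -ler_sqr ?nnegrE//.
  by rewrite !real_normK ?num_real.
nra.
Qed.

End finite_sums.

Section ell2_facts.
Context {R : realType} {X : choiceType} {V : normedModType R[i]}.
Implicit Types (f g : ell2 X V) (s t : seq X).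

Lemma cnorm_ell2 f : cnorm f = ell2norm f.
Proof. by []. Qed.

Lemma ell2_sum_le f t : uniq t -> \sum_(x <- t) cnorm (f x) ^+ 2 <= cnorm f ^+ 2.
Proof.
move=> ut; rewrite cnorm_ell2 -lee_fin -ell2sumE; apply: esum_ge.
exists [set` t]; first by split => //; exact: finite_seq.
by rewrite -fsbig_seq// sumEFin.
Qed.

Lemma esum_le_seq (F : X -> R) (c : R) : (forall x, 0 <= F x) ->
  (forall t, uniq t -> \sum_(x <- t) F x <= c) ->
  (\esum_(x in [set: X]) (F x)%:E <= c%:E)%E.
Proof.
move=> F0 Fc; apply: ge_ereal_sup => _ [A [finA _] <-].
by rewrite fsbig_finite// sumEFin lee_fin Fc.
Qed.

Lemma ell2_of_bound (g : X -> V) (c : R) : 0 <= c ->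
  (forall t, uniq t -> \sum_(x <- t) cnorm (g x) ^+ 2 <= c ^+ 2) ->
  exists f, (forall x, f x = g x) /\ cnorm f <= c.
Proof.
move=> c0 gc.
have gle : (ell2sum g <= (c ^+ 2)%:E)%E by apply: esum_le_seq => // x; exact: sqr_ge0.
have gl : g \in is_ell2 (V := V) by rewrite inE /=; apply: le_lt_trans gle (ltry _).
by exists (Ell2 gl); split => //; exact: ell2norm_le.
Qed.

Lemma ell2norm_le_seq f (c : R) : 0 <= c ->
  (forall t, uniq t -> \sum_(x <- t) cnorm (f x) ^+ 2 <= c ^+ 2) -> cnorm f <= c.
Proof.
move=> c0 /(ell2_of_bound c0)[g [gf gc]].
by suff <- : g = f by []; apply: ell2_eq => x; exact: gf.
Qed.

Lemma ell2_coord f x : cnorm (f x) <= cnorm f.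
Proof.
rewrite -ler_sqr ?nnegrE ?cnorm_ge0//.
by have := @ell2_sum_le f [:: x] isT; rewrite big_seq1.
Qed.

Lemma ell2D f g x : (f + g) x = f x + g x. Proof. by []. Qed.
Lemma ell2N f x : (- f) x = - f x. Proof. by []. Qed.
Lemma ell2Z (a : R[i]) f x : (a *: f) x = a *: f x. Proof. by []. Qed.
Lemma ell2_sum (I : Type) (r : seq I) (F : I -> ell2 X V) x :
  (\sum_(i <- r) F i) x = \sum_(i <- r) F i x.
Proof. by elim/big_rec2: _ => // i a b _ <-. Qed.

Lemma ell2_deltaE (x : X) (v : V) (y : X) : ell2_delta x v y = if y == x then v else 0.
Proof. by []. Qed.

Lemma ell2_delta_sumE s (h : X -> V) x : uniq s ->
  (\sum_(y <- s) ell2_delta y (h y)) x = if x \in s then h x else 0.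
Proof.
move=> us; rewrite ell2_sum; case: ifPn => xs; last first.
  by rewrite big1_seq// => y /= ys; case: eqP xs => // ->; rewrite ys.
rewrite (bigD1_seq x)//= eqxx big1 ?addr0// => y; rewrite eq_sym => /negbTE yx.
by rewrite yx.
Qed.

Lemma ell2_delta_linear (x : X) : linear (@ell2_delta R X V x).
Proof.
move=> a u v; apply: ell2_eq => y; rewrite ell2D ell2Z !ell2_deltaE.
by case: eqP => // _; rewrite scaler0 addr0.
Qed.

Lemma ell2_delta_sum_norm s (h : X -> V) : uniq s ->
  cnorm (\sum_(y <- s) ell2_delta y (h y)) ^+ 2 <= \sum_(y <- s) cnorm (h y) ^+ 2.
Proof.
move=> us; set c := \sum_(y <- s) cnorm (h y) ^+ 2.
have c0 : 0 <= c by apply: sumr_ge0 => i _; exact: sqr_ge0.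
rewrite -[leRHS](sqr_sqrtr c0) ler_sqr ?nnegrE ?cnorm_ge0 ?sqrtr_ge0//.
apply: ell2norm_le_seq; first exact: sqrtr_ge0.
move=> t ut; rewrite sqr_sqrtr//.
apply: (@le_trans _ _ (\sum_(x <- t | x \in s) cnorm (h x) ^+ 2)).
  rewrite [leRHS]big_mkcond/=; apply: ler_sum => x _; rewrite ell2_delta_sumE//.
  by case: ifP => //; rewrite cnorm0 expr0n.
rewrite -big_filter; apply: ler_sum_sub => //; first exact: filter_uniq.
  by move=> i; exact: sqr_ge0.
by move=> x; rewrite mem_filter => /andP[].
Qed.

Lemma ell2_delta_norm (x : X) (v : V) : cnorm (ell2_delta x v) <= cnorm v.
Proof.
rewrite -ler_sqr ?nnegrE ?cnorm_ge0//.
by have := @ell2_delta_sum_norm [:: x] (fun=> v) isT; rewrite !big_seq1.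
Qed.

Lemma ell2_finite_approx f (e : R) : 0 < e ->
  exists2 s, uniq s & cnorm (f - \sum_(y <- s) ell2_delta y (f y)) <= e.
Proof.
move=> e0.
have : (((cnorm f) ^+ 2 - e ^+ 2)%:E < ell2sum f)%E.
  by rewrite cnorm_ell2 ell2sumE lte_fin ltrBlDr ltrDl exprn_gt0.
move=> /ereal_sup_gt[_ [A [finA _] <-]].
rewrite fsbig_finite// sumEFin lte_fin; set s := enum_fset _ => hs.
have us : uniq s by exact: fset_uniq.
exists s => //; apply: ell2norm_le_seq; first exact: ltW.
move=> t ut.
have -> : \sum_(x <- t) cnorm ((f - \sum_(y <- s) ell2_delta y (f y)) x) ^+ 2 =
    \sum_(x <- [seq x <- t | x \notin s]) cnorm (f x) ^+ 2.
  rewrite big_filter [RHS]big_mkcond; apply: eq_bigr => x _.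
  rewrite ell2D ell2N ell2_delta_sumE//; case: ifP => _; last by rewrite subr0.
  by rewrite subrr cnorm0 expr0n.
have := @ell2_sum_le f (s ++ [seq x <- t | x \notin s]).
rewrite cat_uniq us filter_uniq// andbT/= big_cat/=.
have -> : ~~ has (mem s) [seq x <- t | x \notin s].
  by apply/hasPn => x; rewrite mem_filter => /andP[].
move=> /(_ isT); move: hs; lra.
Qed.

End ell2_facts.

Section schur.
Context {R : realType} {X : choiceType} {H : normedModType R[i]}.
Implicit Types (f g : ell2 X H) (s t : seq X).

Lemma mem_undup_flatten (I : eqType) (s : X -> seq I) t x y :
  x \in t -> y \in s x -> y \in undup (flatten (map s t)).
Proof.
by move=> xt ys; rewrite mem_undup; apply/flatten_mapP; exists x.
Qed.

(** Only a pointwise domination of g is asked for, so the test applies before g is known to be in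
    l^2 and serves to construct it. *)
Lemma schur_test (s : X -> seq X) (b : X -> X -> R) (c : R) f (g : X -> H) :
  0 <= c -> (forall x, uniq (s x)) -> (forall x y, 0 <= b x y) ->
  (forall x, \sum_(y <- s x) b x y <= c) ->
  (forall y t, uniq t -> \sum_(x <- t | y \in s x) b x y <= c) ->
  (forall x, cnorm (g x) <= \sum_(y <- s x) b x y * cnorm (f y)) ->
  forall t, uniq t -> \sum_(x <- t) cnorm (g x) ^+ 2 <= (c * cnorm f) ^+ 2.
Proof.
move=> c0 us b0 rowc colc gb t ut.
have gx x : cnorm (g x) ^+ 2 <= c * \sum_(y <- s x) b x y * cnorm (f y) ^+ 2.
  apply: (@le_trans _ _ ((\sum_(y <- s x) b x y * cnorm (f y)) ^+ 2)).
    rewrite ler_sqr ?nnegrE ?cnorm_ge0//.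
    by apply: sumr_ge0 => y _; rewrite mulr_ge0// cnorm_ge0.
  apply: (@le_trans _ _ ((\sum_(y <- s x) b x y) *
     \sum_(y <- s x) b x y * cnorm (f y) ^+ 2)).
    apply: weighted_cauchy_schwarz => [y|//|y]; last by rewrite mulr_ge0 ?sqr_ge0.
    by rewrite exprMn mulrA -expr2.
  rewrite ler_wpM2r// sumr_ge0// => y _; by rewrite mulr_ge0 ?sqr_ge0.
pose Y := undup (flatten (map s t)).
have uY : uniq Y by exact: undup_uniq.
apply: (@le_trans _ _ (\sum_(x <- t) c * \sum_(y <- Y | y \in s x) b x y * cnorm (f y) ^+ 2)).
  rewrite big_seq [leRHS]big_seq; apply: ler_sum => x xt; apply: le_trans (gx x) _.
  rewrite ler_wpM2l// -[leRHS]big_filter; apply: ler_sum_sub => //; first exact: filter_uniq.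
    by move=> y; rewrite mulr_ge0 ?sqr_ge0.
  by move=> y ys; rewrite mem_filter ys; exact: mem_undup_flatten xt ys.
rewrite -mulr_sumr exprMn [c ^+ 2]expr2 -mulrA ler_wpM2l//.
rewrite (exchange_big_dep xpredT)//=.
apply: (@le_trans _ _ (\sum_(y <- Y) c * cnorm (f y) ^+ 2)).
  apply: ler_sum => y _; rewrite -mulr_suml ler_wpM2r ?sqr_ge0//.
  exact: colc.
by rewrite -mulr_sumr ler_wpM2l//; exact: ell2_sum_le.
Qed.

End schur.

Section entries.
Context {R : realType} (X : metricType R) (H : hilbertType R).
Implicit Types (T W : roe_op X H) (f g : ell2 X H) (s t : seq X).

Lemma entry_linear T x y : linear (entry T x y).
Proof. by move=> a u v; rewrite /entry ell2_delta_linear linearP. Qed.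

Lemma entry_bound T (c : R) x y v : opnorm_le T c -> 0 <= c ->
  cnorm (entry T x y v) <= c * cnorm v.
Proof.
move=> /opnorm_leP Tc c0; apply: le_trans (ell2_coord _ _) _.
by apply: le_trans (Tc _) _; rewrite ler_wpM2l// ell2_delta_norm.
Qed.

Lemma op_bound_ge0 T : exists2 c : R, 0 <= c & forall f, cnorm (T f) <= c * cnorm f.
Proof.
have [c /opnorm_leP Tc] := op_bounded T; exists `|c| => // f.
by apply: le_trans (Tc _) _; rewrite ler_wpM2r ?cnorm_ge0// ler_norm.
Qed.

Lemma entry_sum T s (h : X -> H) x :
  T (\sum_(y <- s) ell2_delta y (h y)) x = \sum_(y <- s) entry T x y (h y).
Proof. by rewrite linear_sum/= ell2_sum. Qed.

(** Entries determine T on finite sums of deltas, and these approximate f. The approximating set is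
    enlarged by s, so that the finite sum already gives the whole row. *)
Lemma finite_row T x s f : uniq s ->
  (forall y, y \notin s -> entry T x y = fun=> 0) ->
  T f x = \sum_(y <- s) entry T x y (f y).
Proof.
move=> us Ts; apply/eqP; rewrite -subr_eq0; apply/eqP/cnorm_eq0/eqP.
rewrite eq_le cnorm_ge0 andbT; apply/ler_addgt0Pr => e e0; rewrite add0r.
have [c c0 Tc] := op_bound_ge0 T.
have c1 : 0 < c + 1 by rewrite ltr_wpDl.
have [t ut ft] := ell2_finite_approx f (divr_gt0 e0 c1).
pose u := undup (s ++ t); have uu : uniq u by exact: undup_uniq.
have fu : cnorm (f - \sum_(y <- u) ell2_delta y (f y)) <= e / (c + 1).
  apply: le_trans ft; rewrite -ler_sqr ?nnegrE ?cnorm_ge0//.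
  rewrite -[leRHS]ger0_norm ?sqr_ge0// normrX.
  apply: (@le_trans _ _ (cnorm (f - \sum_(y <- t) ell2_delta y (f y)) ^+ 2)); last first.
    by rewrite ger0_norm ?cnorm_ge0.
  rewrite ler_sqr ?nnegrE ?cnorm_ge0//; apply: ell2norm_le_seq; first exact: cnorm_ge0.
  move=> r ur; apply: le_trans (ell2_sum_le _ ur); apply: ler_sum => x' _.
  rewrite !ell2D !ell2N !ell2_delta_sumE//.
  case: ifPn => [_|]; first by rewrite subrr cnorm0 expr0n sqr_ge0.
  by rewrite mem_undup mem_cat negb_or => /andP[_ /negbTE ->].
have -> : \sum_(y <- s) entry T x y (f y) = T (\sum_(y <- u) ell2_delta y (f y)) x.
  rewrite entry_sum; apply: eq_big_support => // y.
    by apply: contraNT => /Ts ->.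
  move=> Ty; have ys : y \in s by apply: contraNT Ty => /Ts ->.
  by rewrite mem_undup mem_cat ys.
have -> : T f x - T (\sum_(y <- u) ell2_delta y (f y)) x =
   T (f - \sum_(y <- u) ell2_delta y (f y)) x by rewrite linearB.
apply: le_trans (ell2_coord _ _) _; apply: le_trans (Tc _) _.
apply: (@le_trans _ _ ((c + 1) * (e / (c + 1)))); last by rewrite mulrC divfK// gt_eqF.
apply: ler_pM; rewrite ?cnorm_ge0//.
by rewrite lerDl.
Qed.

Lemma sum_ball_le (r : R) (N : nat) (b : X -> seq X) (c : R) y t :
  is_ball_enum r N b -> 0 <= c -> uniq t ->
  \sum_(x <- t | mdist x y <= r) c <= c * N%:R.
Proof.
move=> bP c0 ut; rewrite -big_filter.
have [uy yb yN] := bP y.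
apply: (@le_trans _ _ (\sum_(x <- b y) c)).
  apply: ler_sum_sub => //; first exact: filter_uniq.
  by move=> x; rewrite mem_filter yb metric_sym => /andP[].
by rewrite big_const_seq count_predT iter_addr_0 -[leLHS]mulr_natr ler_wpM2l// ler_nat.
Qed.

(** The Schur test with constant weight c on r-balls gives norm at most c N, a bound that grows with
    the propagation. *)
Lemma matrix_op (r : R) (N : nat) (b : X -> seq X) (M : X -> X -> H -> H) (c : R) :
  is_ball_enum r N b -> 0 <= c -> (forall x y, linear (M x y)) ->
  (forall x y v, cnorm (M x y v) <= c * cnorm v) ->
  exists W : roe_op X H, (forall f x, W f x = \sum_(y <- b x) M x y (f y)) /\
    forall x y, entry W x y = fun v => if mdist x y <= r then M x y v else 0.
Proof.
move=> bP c0 lM Mc.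
have ex f : exists G : ell2 X H, (forall x, G x = \sum_(y <- b x) M x y (f y)) /\
    cnorm G <= c * N%:R * cnorm f.
  apply: ell2_of_bound; first by rewrite !mulr_ge0 ?cnorm_ge0.
  apply: (schur_test (s := b) (b := fun _ _ => c)) => //.
  - by rewrite mulr_ge0.
  - by move=> x; have [] := bP x.
  - move=> x; have [_ _ bN] := bP x.
    by rewrite big_const_seq count_predT iter_addr_0 -[leLHS]mulr_natr ler_wpM2l// ler_nat.
  - move=> y t ut; apply: le_trans (sum_ball_le y bP c0 ut).
    by rewrite (eq_bigl (fun x => mdist x y <= r))// => x; have [_ ->] := bP x.
  - move=> x; apply: le_trans (cnorm_sum _ _ _) _.
    by apply: ler_sum => y _; exact: Mc.
pose F f := projT1 (cid (ex f)).
have FE f x : F f x = \sum_(y <- b x) M x y (f y) by rewrite /F; case: cid => G [].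
have Fc f : cnorm (F f) <= c * N%:R * cnorm f by rewrite /F; case: cid => G [].
have lF : linear F.
  move=> a f g; apply: ell2_eq => x; rewrite ell2D ell2Z !FE scaler_sumr -big_split/=.
  by apply: eq_bigr => y _; exact: lM.
have [G FG] := linear_bundle lF.
have bG : exists c, opnorm_le G c.
  by exists (c * N%:R); apply/opnorm_leP => f; rewrite -FG.
exists (BoundedOp bG); have WE f x : BoundedOp bG f x = \sum_(y <- b x) M x y (f y).
  by rewrite /= -FG.
split => // x y; apply/funext => v; rewrite /entry WE.
have [ub by_ _] := bP x; rewrite -by_.
have M0 z : M x z 0 = 0 by have [g ->] := linear_bundle (lM x z); rewrite linear0.
case: ifPn => yb; last first.
  by rewrite big1_seq// => z /= zb; case: eqP zb => // ->; rewrite (negbTE yb).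
rewrite (bigD1_seq y)//= eqxx big1 ?addr0// => z zy.
by rewrite (negbTE zy).
Qed.

End entries.

(** * Schur multipliers with a Gram kernel *)

Section schur_multiplier.
Context {R : realType} (X : metricType R) (H : hilbertType R).
Implicit Types (T W : roe_op X H) (f g : ell2 X H) (s t : seq X).
Variables (S : R) (N : nat) (b : X -> seq X) (a : X -> X -> R) (C : R).
Hypothesis bP : is_ball_enum S N b.
Hypothesis aS : forall z x, a z x != 0 -> mdist z x <= S.
Hypothesis C0 : 0 <= C.
Hypothesis aC : forall x t, uniq t -> \sum_(z <- t) a z x ^+ 2 <= C.

(** Multiplication a_z by the function [a z], supported near z; the Schur multiplier is T |-> sum_z
    a_z T a_z. *)
Definition localize z f : ell2 X H := \sum_(y <- b z) ell2_delta y ((a z y)%:C *: f y).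

Let ub x : uniq (b x). Proof. by have [] := bP x. Qed.
Let bE x y : (y \in b x) = (mdist x y <= S). Proof. by have [] := bP x. Qed.

(** The map f |-> (a_z f)_z and its adjoint have norm at most sqrt C, and T acts between them on
    each component; hence the bound C c, free of S and N. T is a bare function so as to apply to an
    unbundled difference of operators. *)
Lemma schur_multiplier (T : ell2 X H -> ell2 X H) (c : R) f : 0 <= c ->
  (forall f, cnorm (T f) <= c * cnorm f) ->
  exists G : ell2 X H,
    (forall x, G x = \sum_(z <- b x) (a z x)%:C *: T (localize z f) x) /\
    cnorm G <= C * c * cnorm f.
Proof.
move=> c0 Tc; apply: ell2_of_bound; first by rewrite !mulr_ge0 ?cnorm_ge0.
move=> t ut; pose Z := undup (flatten (map b t)).
have uZ : uniq Z by exact: undup_uniq.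
apply: (@le_trans _ _ (\sum_(x <- t) C * \sum_(z <- Z) cnorm (T (localize z f) x) ^+ 2)).
  rewrite big_seq [leRHS]big_seq; apply: ler_sum => x xt.
  apply: (@le_trans _ _ ((\sum_(z <- b x) a z x ^+ 2) *
     \sum_(z <- b x) cnorm (T (localize z f) x) ^+ 2)); last first.
    apply: ler_pM; rewrite ?aC//.
    - by apply: sumr_ge0 => z _; exact: sqr_ge0.
    - by apply: sumr_ge0 => z _; exact: sqr_ge0.
    - apply: ler_sum_sub => //; first by move=> z; exact: sqr_ge0.
      by move=> z zb; exact: mem_undup_flatten xt zb.
  apply: (@le_trans _ _ ((\sum_(z <- b x) `|a z x| * cnorm (T (localize z f) x)) ^+ 2)).
    rewrite ler_sqr ?nnegrE ?cnorm_ge0//; last first.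
      by apply: sumr_ge0 => z _; rewrite mulr_ge0// cnorm_ge0.
    apply: le_trans (cnorm_sum _ _ _) _.
    by apply: ler_sum => z _; rewrite cnormZr.
  apply: weighted_cauchy_schwarz => z; rewrite ?sqr_ge0//.
  by rewrite exprMn real_normK ?num_real.
rewrite -mulr_sumr exchange_big/=.
have -> : (C * c * cnorm f) ^+ 2 = C * (c ^+ 2 * (C * cnorm f ^+ 2)) by ring.
rewrite ler_wpM2l//.
apply: (@le_trans _ _ (\sum_(z <- Z) c ^+ 2 * cnorm (localize z f) ^+ 2)).
  apply: ler_sum => z _; apply: le_trans (ell2_sum_le _ ut) _.
  by rewrite -exprMn ler_sqr ?nnegrE ?cnorm_ge0 ?mulr_ge0 ?cnorm_ge0//; exact: Tc.
rewrite -mulr_sumr ler_wpM2l ?sqr_ge0//.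
pose Y := undup (flatten (map b Z)).
have uY : uniq Y by exact: undup_uniq.
apply: (@le_trans _ _ (\sum_(z <- Z) \sum_(y <- Y) a z y ^+ 2 * cnorm (f y) ^+ 2)).
  rewrite big_seq [leRHS]big_seq; apply: ler_sum => z zZ.
  apply: le_trans (ell2_delta_sum_norm _ (ub z)) _.
  apply: (@le_trans _ _ (\sum_(y <- b z) a z y ^+ 2 * cnorm (f y) ^+ 2)).
    by apply: ler_sum => y _; rewrite cnormZr exprMn real_normK ?num_real.
  apply: ler_sum_sub => //; first by move=> y; rewrite mulr_ge0 ?sqr_ge0.
  by move=> y yb; exact: mem_undup_flatten zZ yb.
rewrite exchange_big/=.
apply: (@le_trans _ _ (\sum_(y <- Y) C * cnorm (f y) ^+ 2)).
  by apply: ler_sum => y _; rewrite -mulr_suml ler_wpM2r ?sqr_ge0// aC.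
by rewrite -mulr_sumr ler_wpM2l//; exact: ell2_sum_le.
Qed.

(** The Gram matrix of the columns of [a]: nothing is lost by summing over [b x], as [a z x]
    vanishes elsewhere. *)
Definition schur_kernel x y := \sum_(z <- b x) a z x * a z y.

Lemma schur_kernel_supp x y : schur_kernel x y != 0 -> mdist x y <= S + S.
Proof.
move=> k0; rewrite leNgt; apply: contra k0 => xy; apply/eqP.
rewrite /schur_kernel big1// => z _; apply/eqP; rewrite mulf_eq0.
rewrite -[_ || _]negbK negb_or; apply/negP => /andP[/aS zx /aS zy].
move: xy; rewrite ltNge => /negP; apply; apply: le_trans (metric_triangle x z y) _.
by apply: lerD => //; rewrite metric_sym.
Qed.

Lemma schur_kernel_le x y : `|schur_kernel x y| <= C.
Proof.
have Cx := aC x (ub x); have Cy := aC y (ub x).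
have : `|schur_kernel x y| <= \sum_(z <- b x) (a z x ^+ 2 / 2 + a z y ^+ 2 / 2).
  apply: le_trans (ler_norm_sum _ _ _) _; apply: ler_sum => z _.
  rewrite ler_norml; have := sqr_ge0 (a z x - a z y); have := sqr_ge0 (a z x + a z y).
  by nra.
rewrite big_split/= -!mulr_suml; lra.
Qed.

Lemma schur_multiplierE T (r : R) (N' : nat) (b' : X -> seq X) f x :
  S + S <= r -> is_ball_enum r N' b' ->
  \sum_(z <- b x) (a z x)%:C *: T (localize z f) x =
  \sum_(y <- b' x) (schur_kernel x y)%:C *: entry T x y (f y).
Proof.
move=> Sr b'P; have [ub' b'E _] := b'P x.
have e0 y : entry T x y 0 = 0.
  by have [g ->] := linear_bundle (entry_linear T x y); rewrite linear0.
transitivity (\sum_(z <- b x) \sum_(y <- b' x) (a z x * a z y)%:C *: entry T x y (f y)).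
  rewrite big_seq [RHS]big_seq; apply: eq_bigr => z zx.
  rewrite /localize entry_sum scaler_sumr.
  have eZ y : entry T x y ((a z y)%:C *: f y) = (a z y)%:C *: entry T x y (f y).
    by have [g ->] := linear_bundle (entry_linear T x y); rewrite linearZ.
  rewrite (eq_bigr (fun y => (a z x * a z y)%:C *: entry T x y (f y))); last first.
    by move=> y _; rewrite eZ scalerA -rmorphM.
  have nz y : (a z x * a z y)%:C *: entry T x y (f y) != 0 -> mdist z y <= S.
    by move=> /eqP n0; apply: aS; apply/eqP => azy; apply: n0; rewrite azy mulr0 scale0r.
  apply: eq_big_support => // y /nz zy; rewrite ?bE// b'E.
  apply: le_trans Sr; apply: le_trans (metric_triangle x z y) _; apply: lerD => //.
  by rewrite -bE.
rewrite exchange_big/=; apply: eq_bigr => y _.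
by rewrite -scaler_suml /schur_kernel rmorph_sum.
Qed.

End schur_multiplier.

(** * The two ideals *)

Section rank_ideals.
Context {R : realType} (X : metricType R) (H : hilbertType R).
Implicit Types (T W : roe_op X H) (U : set (beta X)).

Lemma RmaxP U (alpha : X * X -> nat) : Rmax U alpha <->
  coarse_entourage (rank_support alpha) /\
  forall p : beta X, p (fst @` rank_support alpha) -> U p.
Proof. by rewrite /Rmax /= closure_beta_pt. Qed.

Lemma Rmax_sub U (alpha alpha' : X * X -> nat) :
  rank_support alpha `<=` rank_support alpha' -> Rmax U alpha' -> Rmax U alpha.
Proof.
move=> aa' /RmaxP[[M HM] HU]; apply/RmaxP; split.
  by exists M => xy /aa'; exact: HM.
by move=> p pa; apply: HU; apply: (filterS _ pa); exact: image_subset.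
Qed.

Lemma entry_opnorm T x y : exists c, opnorm_le (entry T x y) c.
Proof.
have [c c0 Tc] := op_bound_ge0 T; exists c; apply/opnorm_leP => v.
by apply: entry_bound => //; apply/opnorm_leP.
Qed.

Lemma entryB_bound T W (e : R) x y v : 0 <= e -> opnorm_le (fun f => T f - W f) e ->
  cnorm (entry T x y v - entry W x y v) <= e * cnorm v.
Proof.
move=> e0 /opnorm_leP TW.
have -> : entry T x y v - entry W x y v = (T (ell2_delta y v) - W (ell2_delta y v)) x by [].
apply: le_trans (ell2_coord _ _) _; apply: le_trans (TW _) _.
by rewrite ler_wpM2l// ell2_delta_norm.
Qed.

Lemma entry_totally_bounded T x y : roe_algebra T -> totally_bounded_op (entry T x y).
Proof.
move=> TR e e0; have e20 : 0 < e / 2 by rewrite divr_gt0.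
have [W [_ Wc] TW] := TR _ e20.
have [s sW] := compact_op_totally_bounded (Wc x y) e20.
exists s => v v1; have [c cs vc] := sW v v1; exists c => //.
have -> : entry T x y v - c = (entry T x y v - entry W x y v) + (entry W x y v - c).
  by rewrite addrA subrK.
apply: le_lt_trans (cnormD _ _) _; rewrite (splitr e) ler_ltD//.
apply: le_trans (entryB_bound x y v (ltW e20) TW) _.
by rewrite ler_piMr// ltW.
Qed.

Lemma truncated_entry_spec T (e : R) x y : roe_algebra T -> 0 < e ->
  [/\ linear (truncated_entry e T x y),
    forall v, cnorm (entry T x y v - truncated_entry e T x y v) <= e * cnorm v,
    forall a : R[i], finite_rank (fun v => a *: truncated_entry e T x y v),
    forall a : R[i], totally_bounded_op (fun v => a *: truncated_entry e T x y v) &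
    forall v, truncated_entry e T x y v != 0 ->
      exists2 w, cnorm w = 1 & e <= cnorm (entry T x y w)].
Proof.
move=> TR e0; apply: truncation_spec => //.
- exact: entry_linear.
- exact: entry_opnorm.
- exact: entry_totally_bounded.
Qed.

Lemma RANK_truncated_neq0 T (e : R) x y : roe_algebra T -> 0 < e ->
  rank_support (RANK (truncated_entry e T)) (x, y) <->
  exists v, truncated_entry e T x y v != 0.
Proof.
move=> TR e0; have [lt _ fr _ _] := truncated_entry_spec x y TR e0.
have {}fr : finite_rank (truncated_entry e T x y).
  by have := fr 1; congr finite_rank; apply/funext => v; rewrite scale1r.
have r0 := rank_eq0 lt fr; rewrite /rank_support /RANK /=; split.
  move=> /eqP n0; apply: contrapT => /forallNP nv; apply: n0; apply/r0 => v.
  by apply/eqP/negPn/negP; exact: nv.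
by move=> [v v0]; apply/eqP => /r0 v0'; rewrite v0' eqxx in v0.
Qed.

Lemma rank_ideal_sub_tilde U : rank_ideal H (Rmax U) `<=` rank_ideal_tilde H (Rmax U).
Proof.
move=> T TI; have TR : roe_algebra T.
  by move=> e e0; have [W [WR _ _] TW] := TI e e0; exists W.
split => // e e0; have e20 : 0 < e / 2 by rewrite divr_gt0.
have [W [_ Wfr WU] TW] := TI _ e20; apply: Rmax_sub WU => -[x y].
move=> /(RANK_truncated_neq0 x y TR e0)[v v0].
have [_ _ _ _ /(_ v v0)[w w1 ew]] := truncated_entry_spec x y TR e0.
apply/eqP => /(rank_eq0 (entry_linear W x y) (Wfr x y)) W0.
have := entryB_bound x y w (ltW e20) TW; rewrite W0 subr0 w1 mulr1; lra.
Qed.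

Section approximation.
Variable U : set (beta X).
Hypothesis bgX : bounded_geometry X.
Hypothesis Uopen : open U.
Hypothesis Uinv : @invariant_units (coarse_groupoid X) U.
Hypothesis UA : partial_property_A U.

(** The left side is (sqrt p - sqrt q)^2: this turns the l^1 invariance of g into l^2 invariance of
    its square root. *)
Lemma sqrt_diff_sqr (p q : R) : 0 <= p -> 0 <= q ->
  p + q - 2 * (Num.sqrt p * Num.sqrt q) <= `|p - q|.
Proof.
wlog pq : p q / q <= p => [hw p0 q0|p0 q0].
  have [pq|/ltW pq] := leP q p; first exact: hw.
  by rewrite distrC [p + q]addrC [_ * Num.sqrt q]mulrC; exact: hw.
rewrite ger0_norm ?subr_ge0//.
have sq : Num.sqrt q <= Num.sqrt p by rewrite ler_wsqrtr.
have := sqr_sqrtr q0; have := sqrtr_ge0 q; nra.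
Qed.

Lemma almost_invariant_kernel (R0 e : R) : 0 <= R0 -> 0 < e -> e <= 1 ->
  exists (D : set X) (S : R) (a : X -> X -> R),
    [/\ forall p : beta X, p D -> U p, 0 <= S,
      forall z x, a z x != 0 -> mdist z x <= S,
      forall z x, D x -> a z x = 0 &
      (forall x t, uniq t -> \sum_(z <- t) a z x ^+ 2 <= 2) /\
      forall b N x y, is_ball_enum S N b -> ~ D x -> ~ D y -> mdist x y <= R0 ->
        `|1 - schur_kernel b a x y| <= 2 * e].
Proof.
move=> R00 e0 e1.
have [D [S [g [DU S0 g0 gS gA]]]] := relative_property_A bgX Uopen Uinv UA R00 e0.
have [N1 [b1 b1P]] := bounded_geometry_balls bgX (S + R0).
pose a z x := if `[< D x >] then 0 else Num.sqrt (g (z, x)).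
have a2 z x : ~ D x -> a z x ^+ 2 = g (z, x).
  by move=> Dx; rewrite /a asboolF// sqr_sqrtr.
have aS z x : a z x != 0 -> mdist z x <= S.
  rewrite /a; case: asboolP => [_|_]; first by rewrite eqxx.
  move=> s0; apply: (gS (z, x)); apply: contraNneq s0 => ->; by rewrite sqrtr0.
have R0S z x : mdist x z <= S -> mdist x z <= S + R0.
  by move=> /le_trans; apply; rewrite lerDl.
exists D, S, a; split => //.
  by move=> z x Dx; rewrite /a asboolT.
split=> [x t ut|b N x y bP Dx Dy xy].
  have [Dx|Dx] := pselect (D x).
    by rewrite big1// => z _; rewrite /a asboolT// expr0n.
  have [ub1 b1E _] := b1P x.
  (* Taking y = x extracts the normalisation alone; the list is enlarged to contain both t and the
     required ball. *)
  have [||h _] := gA x x (undup (t ++ b1 x)) Dx _ (undup_uniq _).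
  - by rewrite mdistxx.
  - by move=> z xz; rewrite mem_undup mem_cat b1E xz orbT.
  apply: (@le_trans _ _ (\sum_(z <- undup (t ++ b1 x)) g (z, x))).
    rewrite (eq_bigr (fun z => g (z, x))); last by move=> z _; exact: a2.
    apply: ler_sum_sub => //; first exact: undup_uniq.
    by move=> z zt; rewrite mem_undup mem_cat zt.
  by move: h; rewrite ltr_norml => /andP[_]; lra.
have [ub bE _] := bP x; have [ub1 b1E _] := b1P x.
have [|h1 h2] := gA x y (b1 x) Dx xy ub1; first by move=> z; rewrite b1E.
have -> : schur_kernel b a x y = \sum_(z <- b1 x) a z x * a z y.
  apply: eq_big_support => // z; rewrite mulf_eq0 negb_or => /andP[/aS zx _].
    by rewrite bE metric_sym.
  by rewrite b1E; apply: R0S; rewrite metric_sym.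
have h3 : \sum_(z <- b1 x) (g (z, x) + g (z, y) - 2 * (a z x * a z y)) <=
    \sum_(z <- b1 x) `|g (z, x) - g (z, y)|.
  by apply: ler_sum => z _; rewrite /a !asboolF//; exact: sqrt_diff_sqr.
have h4 : 0 <= \sum_(z <- b1 x) (g (z, x) + g (z, y) - 2 * (a z x * a z y)).
  apply: sumr_ge0 => z _; rewrite -!a2//.
  have -> : a z x ^+ 2 + a z y ^+ 2 - 2 * (a z x * a z y) = (a z x - a z y) ^+ 2 by ring.
  exact: sqr_ge0.
have h5 : `|\sum_(z <- b1 x) g (z, x) - \sum_(z <- b1 x) g (z, y)| <=
    \sum_(z <- b1 x) `|g (z, x) - g (z, y)|.
  by rewrite -sumrB; exact: ler_norm_sum.
rewrite sumrB big_split/= -mulr_sumr in h3 h4.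
(* 1 - k = (1 - p) + (p - q) / 2 + (p + q - 2 k) / 2, with terms at most e, e / 2 and e / 2. *)
have aux (p q k d : R) : `|p - 1| < e -> d < e -> p + q - 2 * k <= d ->
    0 <= p + q - 2 * k -> `|p - q| <= d -> `|1 - k| <= 2 * e.
  rewrite ltr_norml !ler_norml => /andP[? ?] ? ? ? /andP[? ?].
  by apply/andP; split; lra.
exact: aux h1 h2 h3 h4 h5.
Qed.


Lemma finite_propagation_radius T : finite_propagation T ->
  exists2 r : R, 0 <= r & forall x y, r < mdist x y -> entry T x y = fun=> 0.
Proof.
move=> [M TM]; exists (Num.max M 0); first by rewrite le_max lexx orbT.
move=> x y; rewrite gt_max => /andP[Mxy _]; apply: contrapT => Txy.
by move: (TM (x, y) Txy) => /=; rewrite leNgt Mxy.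
Qed.

Lemma rank_ideal_tilde_sub : rank_ideal_tilde H (Rmax U) `<=` rank_ideal H (Rmax U).
Proof.
move=> T [TR TU] e e0.
(* Budget: e / 6 for T - T', 2 (e / 6) for its image under a multiplier of bound 2, and e / 2 for
   the matrix [z]. *)
have d0 : 0 < e / 6 by rewrite divr_gt0.
have [T' [T'fp T'lc] TT'] := TR _ d0.
have [R0 R00 T'0] := finite_propagation_radius T'fp.
have [N0 [b0 b0P]] := bounded_geometry_balls bgX R0.
have [cT cT0 cTP] := op_bound_ge0 T.
have [c' c'0 c'P] := op_bound_ge0 T'.
have T'R : roe_algebra T'.
  by move=> d d0'; exists T' => //; apply/opnorm_leP => f;
    rewrite subrr cnorm0 mulr_ge0 ?cnorm_ge0// ltW.
(* Only [c'] and [N0], both attached to T', enter here. The minimum with 1 keeps the column sums of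
   the kernel at most 2. *)
pose ep := Num.min 1 (e / (8 * (c' + 1) * (N0%:R + 1))).
have den0 : 0 < 8 * (c' + 1) * (N0%:R + 1) by rewrite !mulr_gt0// ltr_wpDl.
have ep0 : 0 < ep by rewrite lt_min ltr01 divr_gt0.
have ep1 : ep <= 1 by rewrite ge_min lexx.
have epc : 2 * ep * c' * N0%:R <= e / 4.
  have h1 : ep * (8 * (c' + 1) * (N0%:R + 1)) <= e.
    by rewrite -ler_pdivlMr// ge_min lexx orbT.
  have h2 : ep * (c' * N0%:R) <= ep * ((c' + 1) * (N0%:R + 1)).
    by rewrite ler_wpM2l ?(ltW ep0)// ler_pM// lerDl.
  move: h1 h2; have -> : ep * (8 * (c' + 1) * (N0%:R + 1)) =
     8 * (ep * ((c' + 1) * (N0%:R + 1))) by ring.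
  have -> : 2 * ep * c' * N0%:R = 2 * (ep * (c' * N0%:R)) by ring.
  move=> h1 h2; lra.
have [D [S [a [DU S0 aS aD [aC ak]]]]] :=
  almost_invariant_kernel R00 ep0 ep1.
have [NS [bS bSP]] := bounded_geometry_balls bgX S.
pose k := schur_kernel bS a.
have kle x y : `|k x y| <= 2 by exact: (schur_kernel_le bSP aC).
have kD x y : D x \/ D y -> k x y = 0.
  by move=> Dxy; apply: big1 => z _; case: Dxy => /aD ->; rewrite ?mul0r ?mulr0.
have kS x y : k x y != 0 -> mdist x y <= S + S by exact: schur_kernel_supp.
pose r := Num.max R0 (S + S).
have R0r : R0 <= r by rewrite le_max lexx.
have SSr : S + S <= r by rewrite le_max lexx orbT.
have [Nr [br brP]] := bounded_geometry_balls bgX r.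
(* Chosen after S, on which Nr depends: an error 3 et in each of Nr entries per row costs at most e
   / 4. *)
pose et := e / (12 * (Nr%:R + 1)).
have et0 : 0 < et by rewrite divr_gt0// mulr_gt0// ltr_wpDl.
have etN : 3 * et * Nr%:R <= e / 4.
  have Nr1 : (Nr%:R + 1 : R) != 0 by rewrite gt_eqF// ltr_wpDl.
  have : 12 * et * (Nr%:R + 1) = e by rewrite /et; field.
  rewrite mulrDr mulr1 => h; have : 12 * et * Nr%:R <= e by move: h et0; lra.
  lra.
(* W has the entries of T' near D and those of Phi T elsewhere, truncated. *)
pose inD x y := `[< D x \/ D y >].
pose Q x y := if inD x y then T' else T.
pose q x y : R := if inD x y then (mdist x y <= R0)%R%:R else k x y.
pose M x y v := (q x y)%:C *: truncated_entry et (Q x y) x y v.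
have QR x y : roe_algebra (Q x y) by rewrite /Q; case: ifP.
have tr x y := truncated_entry_spec x y (QR x y) et0.
have qle x y : `|q x y| <= 2.
  rewrite /q; case: ifP => _; last exact: kle.
  by rewrite normr_nat ler_nat; case: (_ <= _)%R.
have qr x y : q x y != 0 -> mdist x y <= r.
  rewrite /q; case: ifP => _ => [|/kS xy]; last exact: le_trans SSr.
  by case: leP => [xy _|_]; [exact: le_trans R0r|rewrite eqxx].
have Mlin x y : linear (M x y).
  have [lt _ _ _ _] := tr x y; move=> c u v; rewrite /M lt scalerDr !scalerA.
  by rewrite mulrC.
have Qb x y v : cnorm (entry (Q x y) x y v) <= (cT + c') * cnorm v.
  have QcP : exists2 c, 0 <= c <= cT + c' & opnorm_le (Q x y) c.
    rewrite /Q; case: ifP => _.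
      by exists c'; [rewrite c'0 lerDr|exact/opnorm_leP].
    by exists cT; [rewrite cT0 lerDl|exact/opnorm_leP].
  have [c /andP[c0 cle] Qc] := QcP.
  by apply: le_trans (entry_bound x y v Qc c0) _; rewrite ler_wpM2r ?cnorm_ge0.
have Mb x y v : cnorm (M x y v) <= 2 * (cT + c' + et) * cnorm v.
  have [_ tb _ _ _] := tr x y; rewrite cnormZr -mulrA.
  apply: ler_pM => //; first exact: cnorm_ge0.
  have := ler_cnormB (truncated_entry et (Q x y) x y v) (entry (Q x y) x y v).
  rewrite cnormB; have := tb v; have := Qb x y v; rewrite !mulrDl; lra.
have [|W [Wf WE]] := matrix_op brP _ Mlin Mb.
  by rewrite !mulr_ge0 ?addr_ge0// ltW.
have {}WE x y : entry W x y = M x y.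
  rewrite WE; apply/funext => v; case: ifPn => // xy; rewrite /M.
  have [->|/qr] := eqVneq (q x y) 0; first by rewrite scale0r.
  by rewrite (negbTE xy).
have Wfr x y : finite_rank (entry W x y).
  by rewrite WE; have [_ _ fr _ _] := tr x y; exact: fr.
have Wq x y v : entry W x y v != 0 -> q x y != 0.
  by rewrite WE /M; apply: contraNneq => ->; rewrite scale0r.
have suppW x y : rank_support (RANK (entry W)) (x, y) -> exists v, entry W x y v != 0.
  move=> /eqP n0; apply: contrapT => /forallNP nv; apply: n0.
  apply/(rank_eq0 (entry_linear W x y) (Wfr x y)) => v.
  by apply/eqP/negPn/negP; exact: nv.
exists W.
  split.
  - split.
      exists r => -[x y] /= Wxy; apply: qr; apply: contrapT => /negP/negPn/eqP q0.
      by apply: Wxy; rewrite WE /M q0; apply/funext => v; rewrite scale0r.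
    move=> x y; rewrite WE; apply: totally_bounded_compact_op.
    by have [_ _ _ tb _] := tr x y; exact: tb.
  - exact: Wfr.
  apply/RmaxP; split.
    by exists r => -[x y] /suppW[v /Wq/qr].
  have /RmaxP[_ TUp] := TU _ et0.
  move=> p pW.
  have [pD|] : p [set x | exists2 y, D y & mdist x y <= R0] \/
      p (fst @` rank_support (RANK (truncated_entry et T))).
  - apply: beta_setU; apply: (filterS _ pW) => x [[x' y] /= /suppW[v Wv] <-{x}].
    have := Wq _ _ _ Wv; move: Wv; rewrite WE /M /q /Q; case: ifPn => Dxy.
      move=> _ xyR0; left; have xy : mdist x' y <= R0.
        by move: xyR0; case: (_ <= _); rewrite ?eqxx.
      case/asboolP : Dxy => [Dx|Dy]; last by exists y.
      by exists x' => //; rewrite mdistxx.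
    move=> Wv _; right; exists (x', y) => //; apply/RANK_truncated_neq0 => //.
    by exists v; apply: contraNneq Wv => ->; rewrite scaler0.
  - exact: (invariant_neighborhood Uinv DU pD).
  - exact: TUp.
apply/opnorm_leP => f.
have [G1 [G1E G1n]] := schur_multiplier bSP (ler0n R 2) aC f (ltW d0)
  (proj1 (opnorm_leP (fun f => T f - T' f) _) TT').
(* z is the matrix of T' - Phi T' + Phi T - W, so that
   T - W = (T - T') - Phi (T - T') + z. *)
pose z x y v := entry T' x y v - (k x y)%:C *: entry T' x y v +
  ((k x y)%:C *: entry T x y v - M x y v).
(* T' vanishes beyond R0, so the kernel error meets at most N0 entries per row; only the truncation
   error is spread over the larger r-balls. *)
pose bt (x y : X) : R := (if mdist x y <= R0 then 2 * ep * c' else 0) + 3 * et.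
have bt0 x y : 0 <= bt x y.
  by rewrite addr_ge0//; [case: ifP => // _; rewrite !mulr_ge0 ?(ltW ep0)|rewrite mulr_ge0// ltW].
have zbt x y v : cnorm (z x y v) <= bt x y * cnorm v.
  have [_ tb _ _ _] := tr x y; have v0 := cnorm_ge0 v.
  have etv : 0 <= et * cnorm v by rewrite mulr_ge0 ?(ltW et0).
  have T'v : cnorm (entry T' x y v) <= c' * cnorm v.
    by apply: entry_bound => //; exact/opnorm_leP.
  rewrite /z /bt /M; move: tb; rewrite /q /Q; case: ifPn => Dxy tb.
    rewrite (kD x y (asboolW Dxy)) !scale0r subr0 sub0r.
    case: (leP (mdist x y) R0) => xy /=.
      rewrite scale1r; apply: le_trans (tb v) _; rewrite mulrDl.
      have : 0 <= 2 * ep * c' * cnorm v by rewrite !mulr_ge0 ?(ltW ep0).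
      lra.
    by rewrite (T'0 _ _ xy) scale0r subrr cnorm0 mulr_ge0// addr_ge0// mulr_ge0// ltW.
  have [nDx nDy] : ~ D x /\ ~ D y.
    by move/asboolP: Dxy => Dxy; split=> ?; apply: Dxy; [left|right].
  apply: le_trans (cnormD _ _) _; rewrite mulrDl; apply: lerD.
    case: (leP (mdist x y) R0) => xy; last by rewrite (T'0 _ _ xy) scaler0 subrr cnorm0 mul0r.
    have -> : entry T' x y v - (k x y)%:C *: entry T' x y v = (1 - k x y)%:C *: entry T' x y v.
      by rewrite rmorphB scalerBl scale1r.
    rewrite cnormZr /=.
    have -> : 2 * ep * c' * cnorm v = (2 * ep) * (c' * cnorm v) by ring.
    apply: ler_pM => //; first exact: cnorm_ge0.
    exact: (ak _ _ _ _ bSP nDx nDy xy).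
  rewrite -scalerBr cnormZr.
  apply: (@le_trans _ _ (2 * (et * cnorm v))); last by move: etv; lra.
  by apply: ler_pM => //; exact: cnorm_ge0.
have bc0 : 0 <= 2 * ep * c' by rewrite !mulr_ge0 ?(ltW ep0).
have et30 : 0 <= 3 * et by rewrite mulr_ge0 ?(ltW et0).
have [||G2 [G2E G2n]] := @ell2_of_bound _ _ _
  (fun x => \sum_(y <- br x) z x y (f y)) (e / 2 * cnorm f).
  by rewrite mulr_ge0 ?cnorm_ge0// divr_ge0// ltW.
  have btsum (A : Type) (s : seq A) (P : pred A) (g : A -> R) :
      \sum_(i <- s | P i) ((if g i <= R0 then 2 * ep * c' else 0) + 3 * et) =
      \sum_(i <- s | P i && (g i <= R0)) 2 * ep * c' + \sum_(i <- s | P i) 3 * et.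
    by rewrite big_split/= -big_mkcondr.
  have btc y t : uniq t -> \sum_(x <- t | y \in br x) bt x y <= e / 2.
    move=> ut; rewrite /bt btsum.
    have h1 : \sum_(x <- t | (y \in br x) && (mdist x y <= R0)) 2 * ep * c' <= 2 * ep * c' * N0%:R.
      apply: le_trans (sum_ball_le y b0P bc0 ut).
      rewrite big_mkcondr [leLHS]big_mkcond [leRHS]big_mkcond/=; apply: ler_sum => x _.
      by case: (y \in br x) => /=; case: ifP.
    have h2 : \sum_(x <- t | y \in br x) 3 * et <= 3 * et * Nr%:R.
      apply: le_trans (sum_ball_le y brP et30 ut).
      by rewrite (eq_bigl (fun x => mdist x y <= r))// => x; have [_ ->] := brP x.
    move: h1 h2; lra.
  apply: (schur_test (s := br) (b := bt)) => //.
  - by rewrite divr_ge0// ltW.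
  - by move=> x; have [] := brP x.
  - move=> x; have [ub _ _] := brP x; rewrite /bt (btsum _ _ xpredT).
    have h1 : \sum_(y <- br x | mdist x y <= R0) 2 * ep * c' <= 2 * ep * c' * N0%:R.
      apply: le_trans (sum_ball_le x b0P bc0 ub).
      by rewrite (eq_bigl (fun y => mdist y x <= R0))// => y; rewrite metric_sym.
    have h2 : \sum_(y <- br x) 3 * et <= 3 * et * Nr%:R.
      apply: le_trans (sum_ball_le x brP et30 ub).
      rewrite -[leRHS]big_filter; apply: ler_sum_sub => //; first exact: filter_uniq.
      by have [_ bE _] := brP x; move=> y yb; rewrite mem_filter yb metric_sym -bE yb.
    move: h1 h2; lra.
  - move=> x; apply: le_trans (cnorm_sum _ _ _) _.
    by apply: ler_sum => y _; exact: zbt.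
have -> : T f - W f = (T f - T' f) - G1 + G2.
  apply: ell2_eq => x; rewrite !ell2D !ell2N G1E G2E.
  have [ub bE _] := brP x.
  have T'f : T' f x = \sum_(y <- br x) entry T' x y (f y).
    apply: finite_row => // y; rewrite bE -ltNge => /(le_lt_trans R0r); exact: T'0.
  have -> : \sum_(w <- bS x) (a w x)%:C *:
      (T (localize bS a w f) - T' (localize bS a w f)) x =
      \sum_(y <- br x) (k x y)%:C *: entry T x y (f y) -
      \sum_(y <- br x) (k x y)%:C *: entry T' x y (f y).
    rewrite -(schur_multiplierE bSP aS T f x SSr brP) -(schur_multiplierE bSP aS T' f x SSr brP).
    by rewrite -sumrB; apply: eq_bigr => w _; rewrite ell2D ell2N scalerBr.
  by rewrite Wf T'f /z big_split/= !sumrB addrACA !opprB !subrKA.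
apply: le_trans (cnormD _ _) _.
apply: (@le_trans _ _ ((cnorm (T f - T' f) + cnorm G1) + cnorm G2)).
  by rewrite lerD2r -[in leRHS](cnormN G1); exact: cnormD.
have := proj1 (opnorm_leP (fun f => T f - T' f) _) TT' f.
move: G1n G2n; have -> : 2 * (e / 6) * cnorm f = e * cnorm f / 3 by field.
have -> : e / 2 * cnorm f = e * cnorm f / 2 by field.
have -> : e / 6 * cnorm f = e * cnorm f / 6 by field.
lra.
Qed.

End approximation.

End rank_ideals.

Theorem proposition5p6 (R : realType) (X : metricType R) (H : hilbertType R)
    (U : set (beta X))
    (discX : forall x : X, open [set x])
    (bgX : bounded_geometry X)
    (sepH : separable H)
    (infH : infinite_dimensional H)
    (U0 : U !=set0)
    (Uopen : open U)
    (Uinv : @invariant_units (coarse_groupoid X) U)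
    (UA : partial_property_A U) :
  rank_ideal H (Rmax U) = rank_ideal_tilde H (Rmax U).
Proof.
apply/seteqP; split; first exact: rank_ideal_sub_tilde.
exact: rank_ideal_tilde_sub.
Qed.
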